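(* Let $n\ge 1$ and let $0<\epsilon\le 1/2$ and $k\ge 0$ be real numbers. Let $\mathcal{P}$ be a two-party quantum communication protocol for the set membership problem $\mathsf{SetMemb}_n$ (Alice holds $x\in\{0,1\}^n$, Bob holds $i\in[n]$, and the output should be $x_i$). Let $\mu$ be the uniform distribution on $\{0,1\}^n\times[n]$ (a product distribution), and suppose $\mathcal{P}$ has error at most $1/2-\epsilon$ with respect to $\mu$. If $L^{\mathcal{P}}(\mathsf{SetMemb}_n,\mu,B,A)\le k$, then \[ L^{\mathcal{P}}(\mathsf{SetMemb}_n,\mu,A,B)\ \ge\ \frac{n}{2^{\epsilon^{-3}(14k+24)}}-2 . \]
   Context: Quantum communication protocols (Yao's model): for a function $f:\mathcal{X}\times\mathcal{Y}\to\mathcal{Z}$, Alice gets $x\in\mathcal{X}$ (stored in her input register $X$) and Bob gets $y\in\mathcal{Y}$ (stored in his input register $Y$). Initially Alice's and Bob's work qubits are in state $|0\rangle$, and they may share an input-independent pure entangled state $|\psi\rangle$ (some of its qubits belong to Alice, the rest to Bob), so the initial state is $|x\rangle|0\rangle_A|\psi\rangle|0\rangle_B|y\rangle$. The players take turns: the player whose turn it is applies a unitary to the qubits she holds that depends only on her own input (i.e. a unitary controlled by her input register), then sends some qubits to the other player. At the end, the last recipient measures designated answer qubits in the computational basis to produce the output $\mathcal{P}(x,y)$. All these choices are fixed in advance by $\mathcal{P}$. $\mathcal{P}$ has error at most $\delta$ with respect to a distribution $\mu$ on $\mathcal{X}\times\mathcal{Y}$ if $\mathbb{E}_{(x,y)\sim\mu}\Pr[\mathcal{P}(x,y)\ne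 f(x,y)]\le\delta$. The set membership problem $\mathsf{SetMemb}_n$ is the function $f:\{0,1\}^n\times[n]\to\{0,1\}$, $f(x,i)=x_i$. Registers: $A,X,B,Y$ denote Alice's work qubits, Alice's input register, Bob's work qubits and Bob's input register at the end of the protocol (just before the final measurement). Running $\mathcal{P}$ with a mixture (resp. superposition) fed to an input register means the register is initialised in that mixed (resp. pure) state and the protocol's input-controlled unitaries are applied. For a product distribution $\mu=\mu_{\mathcal{X}}\times\mu_{\mathcal{Y}}$, write $|\mu_{\mathcal{X}}\rangle=\sum_x\sqrt{\mu_{\mathcal{X}}(x)}|x\rangle$ and $|\mu_{\mathcal{Y}}\rangle=\sum_y\sqrt{\mu_{\mathcal{Y}}(y)}|y\rangle$. Superpositional privacy loss: $L^{\mathcal{P}}(f,\mu,A,B):=I(X:BY)$ evaluated at the end of the run of $\mathcal{P}$ in which the mixture $\sum_x\mu_{\mathcal{X}}(x)|x\rangle\langle x|$ is fed to $X$ and the superposition $|\mu_{\mathcal{Y}}\rangle$ is fed to $Y$. Symmetrically, $L^{\mathcal{P}}(f,\mu,B,A):=I(Y:AX)$ evaluated at the end of the run in which the mixture $\sum_y\mu_{\mathcal{Y}}(y)|y\rangle\langle y|$ is fed to $Y$ and the superposition $|\mu_{\mathcal{X}}\rangle$ is fed to $X$. Here $I(R:S)=S(R)+S(S)-S(RS)$ is quantum mutual information with von Neumann entropy $S(\rho)=-\mathrm{Tr}\,\rho\log_2\rho$. *)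

(* Defs.v *)
From HB Require Import structures.
From mathcomp Require Import all_boot all_order all_algebra.
From mathcomp Require Import reals exp complex.
Unset Printing Implicit Defensive.
Import Order.TTheory GRing.Theory Num.Theory.
Local Open Scope ring_scope.

(* Finite-dimensional linear algebra over C = R[i], with operators on the
   Hilbert space C^T (T a finite set of basis labels) given by their
   matrix entries  A i j = <i|A|j>.                                     *)

Definition op (R : realType) (T : finType) := T -> T -> R[i].

Definition opmul {R : realType} {T : finType} (A B : op R T) : op R T :=
  fun i j => \sum_k A i k * B k j.

Definition adj {R : realType} {T : finType} (A : op R T) : op R T :=
  fun i j => (A j i)^*.

Definition idop {R : realType} {T : finType} : op R T :=
  fun i j => (i == j)%:R.

Definition unitary {R : realType} {T : finType} (U : op R T) : Prop :=
  opmul U (adj U) = @idop R T /\ opmul (adj U) U = @idop R T.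

Definition evolve {R : realType} {T : finType} (U rho : op R T) : op R T :=
  opmul (opmul U rho) (adj U).

Definition ketbra {R : realType} {T : finType} (v : T -> R[i]) : op R T :=
  fun i j => v i * (v j)^*.

Definition opmx {R : realType} {T : finType} (A : op R T) : 'M[R[i]]_#|T| :=
  \matrix_(i, j) A (enum_val i) (enum_val j).

Definition eigenvalues {R : realType} {T : finType} (A : op R T) : seq R[i] :=
  sval (closed_field_poly_normal (char_poly (opmx A))).

Definition log2 {R : realType} (r : R) : R := ln r / ln 2.

Definition xlog2x {R : realType} (r : R) : R :=
  if 0 < r then r * log2 r else 0.

Definition vN_entropy {R : realType} {T : finType} (rho : op R T) : R :=
  - \sum_(l <- eigenvalues rho) xlog2x (complex.Re l).

(* Partial trace.  The basis of the total system is T; [keep : T -> U]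
   gives the labels of the kept subsystem and [drop : T -> V] those of the
   traced-out subsystem (with t |-> (keep t, drop t) a bijection T ~ U*V in
   every use below).  Result:  (Tr_V rho) u u'.                          *)
Definition ptrace {R : realType} {T U V : finType} (keep : T -> U)
  (drop : T -> V) (rho : op R T) : op R U :=
  fun u u' => \sum_t \sum_t'
     (if [&& keep t == u, keep t' == u' & drop t == drop t'] then rho t t'
      else 0).

(* Qubits.  A protocol uses nq qubits (work qubits of both players plus the
   shared entangled state); a computational basis configuration of all of
   them is an element of  Q nq.  For a set S of qubits, QS S is the set of
   configurations of the qubits in S, and qres S restricts.              *)

Definition Q (nq : nat) := {ffun 'I_nq -> bool}.
Definition qsub {nq : nat} (S : {set 'I_nq}) := {i : 'I_nq | i \in S}.
Definition QS {nq : nat} (S : {set 'I_nq}) := {ffun qsub S -> bool}.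
Definition qres {nq : nat} (S : {set 'I_nq}) (q : Q nq) : QS S :=
  [ffun i => q (val i)].

Definition lift_op {R : realType} {nq : nat} (S : {set 'I_nq})
  (V : op R (QS S)) : op R (Q nq) :=
  fun q q' => if [forall i, (i \notin S) ==> (q i == q' i)]
              then V (qres S q) (qres S q') else 0.

(* Two-party quantum protocols (Yao's model) with input sets X (Alice)
   and Y (Bob).  Rounds are t = 0, ..., nr.  own t is the set of qubits
   held by Alice at the beginning of round t (Bob holds the complement);
   own nr.+1 is the final distribution.  The player of round t is Alice
   iff alice_turn t (players alternate, [start] says who starts).  In an
   Alice round she applies  UA t x  to her qubits (a unitary depending on
   her input x), in a Bob round Bob applies UB t y to his; then the player
   sends some of her qubits (ownership change).  [init] is the initial
   (input-independent) pure state of all qubits: the work qubits in |0>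
   together with the shared entangled state |psi>.  At the end the last
   recipient measures the answer qubit [ans] in the computational basis. *)

Record protocol (R : realType) (X Y : finType) := Protocol {
  nq : nat;
  nr : nat;
  start : bool;
  own : nat -> {set 'I_nq};
  init : Q nq -> R[i];
  UA : forall t : nat, X -> op R (QS (own t));
  UB : forall t : nat, Y -> op R (QS (~: own t));
  ans : 'I_nq }.

Arguments nq {R X Y} p.
Arguments nr {R X Y} p.
Arguments start {R X Y} p.
Arguments own {R X Y} p _.
Arguments init {R X Y} p _.
Arguments UA {R X Y} p t _ _ _.
Arguments UB {R X Y} p t _ _ _.
Arguments ans {R X Y} p.

Definition alice_turn {R : realType} {X Y : finType} (P : protocol R X Y)
  (t : nat) : bool := start P (+) odd t.

Definition valid_protocol {R : realType} {X Y : finType}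
  (P : protocol R X Y) : Prop :=
  [/\ \sum_q `|init P q| ^+ 2 = 1,
      (forall t x, (t <= nr P)%N -> alice_turn P t -> unitary (UA P t x)),
      (forall t y, (t <= nr P)%N -> ~~ alice_turn P t -> unitary (UB P t y)),
      (forall t, (t <= nr P)%N ->
         if alice_turn P t then own P t.+1 \subset own P t
         else own P t \subset own P t.+1) &
      (if alice_turn P (nr P) then ans P \notin own P (nr P).+1
       else ans P \in own P (nr P).+1)].

Definition Glob {R : realType} {X Y : finType} (P : protocol R X Y) :=
  (X * Q (nq P) * Y)%type.

Definition round_op {R : realType} {X Y : finType} (P : protocol R X Y)
  (t : nat) : op R (X * Q (nq P) * Y)%type :=
  fun a b =>
    let: (x, q, y) := a in let: (x', q', y') := b in
    (x == x')%:R * (y == y')%:R *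
    (if alice_turn P t then lift_op (own P t) (UA P t x) q q'
     else lift_op (~: own P t) (UB P t y) q q').

Definition run {R : realType} {X Y : finType} (P : protocol R X Y)
  (rho0 : op R (X * Q (nq P) * Y)%type) : op R (X * Q (nq P) * Y)%type :=
  foldl (fun rho t => evolve (round_op P t) rho) rho0 (iota 0 (nr P).+1).

Definition init_state {R : realType} {X Y : finType} (P : protocol R X Y)
  (rhoX : op R X) (rhoY : op R Y) : op R (X * Q (nq P) * Y)%type :=
  fun a b =>
    let: (x, q, y) := a in let: (x', q', y') := b in
    rhoX x x' * ketbra (init P) q q' * rhoY y y'.

Definition basis_state {R : realType} {T : finType} (t : T) : op R T :=
  fun i j => ((i == t) && (j == t))%:R.
Definition mixture {R : realType} {T : finType} (mu : T -> R) : op R T :=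
  fun i j => if i == j then (mu i)%:C%C else 0.
Definition superposition {R : realType} {T : finType} (mu : T -> R) : op R T :=
  ketbra (fun t => (Num.sqrt (mu t))%:C%C).

Definition out_prob {R : realType} {X Y : finType} (P : protocol R X Y)
  (x : X) (y : Y) (b : bool) : R :=
  let rho := run P (init_state P (@basis_state R X x) (@basis_state R Y y)) in
  complex.Re (\sum_(a : X * Q (nq P) * Y | a.1.2 (ans P) == b) rho a a).

Definition dist_error {R : realType} {X Y : finType} (P : protocol R X Y)
  (f : X -> Y -> bool) (muX : X -> R) (muY : Y -> R) : R :=
  \sum_x \sum_y muX x * muY y * out_prob P x y (~~ f x y).

Definition finalA {R : realType} {X Y : finType} (P : protocol R X Y) :=
  own P (nr P).+1.
Definition finalB {R : realType} {X Y : finType} (P : protocol R X Y) :=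
  ~: own P (nr P).+1.

(* Superpositional privacy loss L^P(f, mu, A, B) = I(X : BY), evaluated at
   the end of the run with the mixture of muX fed to X and the
   superposition |muY> fed to Y. *)
Definition loss_AB {R : realType} {X Y : finType} (P : protocol R X Y)
  (muX : X -> R) (muY : Y -> R) : R :=
  let rho := run P (init_state P (mixture muX) (superposition muY)) in
  let SA := finalA P in let SB := finalB P in
  vN_entropy (ptrace (fun a : Glob P => a.1.1)
                     (fun a : Glob P => (a.1.2, a.2)) rho)
  + vN_entropy (ptrace (fun a : Glob P => (qres SB a.1.2, a.2))
                       (fun a : Glob P => (a.1.1, qres SA a.1.2)) rho)
  - vN_entropy (ptrace (fun a : Glob P => (a.1.1, qres SB a.1.2, a.2))
                       (fun a : Glob P => qres SA a.1.2) rho).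

(* L^P(f, mu, B, A) = I(Y : AX), evaluated at the end of the run with the
   mixture of muY fed to Y and the superposition |muX> fed to X. *)
Definition loss_BA {R : realType} {X Y : finType} (P : protocol R X Y)
  (muX : X -> R) (muY : Y -> R) : R :=
  let rho := run P (init_state P (superposition muX) (mixture muY)) in
  let SA := finalA P in let SB := finalB P in
  vN_entropy (ptrace (fun a : Glob P => a.2)
                     (fun a : Glob P => (a.1.1, a.1.2)) rho)
  + vN_entropy (ptrace (fun a : Glob P => (qres SA a.1.2, a.1.1))
                       (fun a : Glob P => (qres SB a.1.2, a.2)) rho)
  - vN_entropy (ptrace (fun a : Glob P => (a.2, qres SA a.1.2, a.1.1))
                       (fun a : Glob P => qres SB a.1.2) rho).

Definition SetMemb (n : nat) (x : {ffun 'I_n -> bool}) (i : 'I_n) : bool :=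
  x i.

Definition unif {R : realType} {T : finType} : T -> R := fun _ => #|T|%:R^-1.

(* Main.v *)
Require Import Defs.
From HB Require Import structures.
From mathcomp Require Import all_boot all_order all_algebra.
From mathcomp Require Import boolp reals sequences exp complex.
From mathcomp Require Import spectral sesquilinear.
From mathcomp Require Import ring lra.
Set Implicit Arguments.
Unset Strict Implicit.
Unset Printing Implicit Defensive.
Import Order.TTheory GRing.Theory Num.Theory.
Local Open Scope ring_scope.
Local Open Scope sesquilinear_scope.

(* Let rho_i be Alice's final state (with X) when Bob's input is i, and rho the
   average of the rho_i; the hypothesis bounds the average of S(rho_i || rho).
   In the run where Bob holds a superposition of inputs, his final registers
   purify rho, so he may steer Alice's side towards rho_i: writing Psi for the
   purification of rho and Phi_i for that of rho_i (as matrices from Bob's side to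
   Alice's), let N = Psi^* G Phi_i where G solves rho G + tau G rho_i = 1.  Then
   N^* N <= 1/(4 tau), while Psi N is within squared distance (D + 1)/L of Phi_i
   when tau = exp(-L) and D = S(rho_i || rho) in nats.  This replaces the substate
   theorem.  For L of order (k + 1)/eps^2, the answer observable pulled back by N
   is thus, for a typical i, an observable on Bob's side of norm at most e^L/4
   correlated with x_i by about eps.  Revealing x one bit at a time, each bit
   costs Holevo information at least the square of that correlation over the
   squared norm, by a quantum Pinsker inequality; summing over the n bits gives
   the bound.  If the answer is on Alice's side, Bob is first given the measured
   answer bit, which raises the information by at most one bit. *)

(** * Spectral decompositions and entropy *)

Section Spec.
Variable R : realType.
Notation C := R[i].

(** The states rho and rho_i need not commute, so no logarithm or quotient of operators is formed.
    The entropy estimates are scalar inequalities in an eigenvalue [p a] of one state and [q b] of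
    the other, summed against the squared overlaps of the two eigenbases, whose row and column sums
    are 1. Dividing these overlaps by q + tau p is what the equation for G becomes in such
    coordinates. N need be neither unitary nor normalised: it only pulls an observable back, and the
    bound exp(L)/4 on its squared norm is the source of the exponential in the theorem.
    Cauchy-Schwarz is replaced by AM-GM with a free parameter t; the steering error is then affine
    in S(rho_i || rho), so it averages over i without singling out good inputs. The two losses
    belong to different runs, but both are built from the same amplitudes [amp], and the observables
    read are diagonal in the inputs. *)

Definition nsq (z : C) : R := complex.Re z ^+ 2 + complex.Im z ^+ 2.

Lemma nsqE (z : C) : (nsq z)%:C%C = z * z^*.
Proof. by case: z => a b; rewrite /nsq; simpc; congr (_ +i* _)%C; rewrite /=; ring. Qed.

Lemma nsq_ge0 z : 0 <= nsq z.
Proof. by rewrite addr_ge0 ?sqr_ge0. Qed.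

Lemma nsqM y z : nsq (y * z) = nsq y * nsq z.
Proof. by apply: (@complexI R); rewrite rmorphM /= !nsqE rmorphM /= mulrACA. Qed.

Lemma nsqJ (z : C) : nsq z^* = nsq z.
Proof. by case: z => a b; rewrite /nsq /= sqrrN. Qed.

Lemma nsqR (r : R) : nsq r%:C%C = r ^+ 2.
Proof. by rewrite /nsq /= expr0n addr0. Qed.

Lemma nsq_eq0 z : (nsq z == 0) = (z == 0).
Proof.
case: z => a b; rewrite /nsq /= paddr_eq0 ?sqr_ge0// !sqrf_eq0.
by apply/andP/eqP => [[/eqP-> /eqP->]//|[-> ->]].
Qed.

Lemma conjC_real (r : R) : Num.conj r%:C%C = r%:C%C :> C.
Proof. by rewrite /= /Num.conj /= oppr0. Qed.

(** AM-GM with weight [t] on (u - v)(u + v), then (u + v)^2 <= 2 (u^2 + v^2), for the real and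
    imaginary parts. Keeping [t] free defers the optimisation. *)
Lemma nsq_diff (f g : C) (t : R) : 0 < t ->
  `|nsq f - nsq g| <= nsq (f - g) / (2 * t) + t * (nsq f + nsq g).
Proof.
move=> t0; case: f => a b; case: g => c d; rewrite /nsq /=.
have aux1 (u v : R) : u ^+ 2 - v ^+ 2 <= (u - v) ^+ 2 / (2 * t) + t * (u ^+ 2 + v ^+ 2).
  rewrite -subr_ge0.
  have -> : (u - v) ^+ 2 / (2 * t) + t * (u ^+ 2 + v ^+ 2) - (u ^+ 2 - v ^+ 2) =
    ((u - v) - t * (u + v)) ^+ 2 / (2 * t) + t / 2 * (u - v) ^+ 2.
    by field; rewrite gt_eqF.
  by apply: addr_ge0; apply: mulr_ge0; rewrite ?sqr_ge0 ?invr_ge0 //; [apply: mulr_ge0|apply: divr_ge0]; rewrite ?ler0n ?ltW.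
have aux (u v : R) : `|u ^+ 2 - v ^+ 2| <= (u - v) ^+ 2 / (2 * t) + t * (u ^+ 2 + v ^+ 2).
  rewrite ler_norml; apply/andP; split; last exact: aux1.
  by rewrite lerNl opprB (addrC (u ^+ 2)) -(sqrrN (u - v)) opprB; exact: aux1.
have := aux a c; have := aux b d => h1 h2.
have -> : a ^+ 2 + b ^+ 2 - (c ^+ 2 + d ^+ 2) = (a ^+ 2 - c ^+ 2) + (b ^+ 2 - d ^+ 2) by ring.
apply: le_trans (ler_normD _ _) _; apply: le_trans (lerD h2 h1) _.
by rewrite le_eqVlt; apply/orP; left; apply/eqP; ring.
Qed.

Definition rdiag n (w : 'I_n -> R) : 'M[C]_n := diag_mx (\row_j (w j)%:C%C).

(** The body of [vN_entropy] read on a matrix, so that the two agree by conversion. *)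
Definition ent n (A : 'M[C]_n) : R :=
  - \sum_(l <- sval (closed_field_poly_normal (char_poly A))) xlog2x (complex.Re l).

(* The rows of U are the conjugates of an eigenbasis of A. *)
Definition eigdec n (A : 'M[C]_n) (U : 'M[C]_n) (w : 'I_n -> R) :=
  U \is unitarymx /\ A = U ^t* *m rdiag w *m U.

Lemma unitary_adjl n (U : 'M[C]_n) : U \is unitarymx -> U ^t* *m U = 1%:M.
Proof. by rewrite -trmxC_unitary => /unitarymxP; rewrite trmxCK. Qed.

Lemma char_poly_conj n (U D : 'M[C]_n) :
  U \is unitarymx -> char_poly (U ^t* *m D *m U) = char_poly D.
Proof.
move=> Uu; have UU := unitary_adjl Uu.
rewrite /char_poly /char_poly_mx !map_mxM /=.
have e : map_mx polyC (U ^t*) *m map_mx polyC U = 1%:M :> 'M[{poly C}]_n.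
  by rewrite -map_mxM UU map_mx1.
have -> : 'X%:M - map_mx polyC (U ^t*) *m map_mx polyC D *m map_mx polyC U =
   map_mx polyC (U ^t*) *m ('X%:M - map_mx polyC D) *m map_mx polyC U.
  by rewrite mulmxBr mulmxBl scalar_mxC -(mulmxA 'X%:M) e mulmx1.
by rewrite !det_mulmx mulrAC -det_mulmx e det1 mul1r.
Qed.

Lemma char_poly_rdiag n (w : 'I_n -> R) :
  char_poly (rdiag w) = \prod_(i < n) ('X - (w i)%:C%C%:P).
Proof.
rewrite char_poly_trig ?diag_mx_is_trig//; apply: eq_bigr => i _.
by rewrite !mxE eqxx.
Qed.

(** The root list in [ent] comes from a choice, but two factorisations of a polynomial into monic
    linear factors agree up to permutation, so any unitary diagonalisation may be used. *)
Lemma ent_eigdec n (A U : 'M[C]_n) w : eigdec A U w ->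
  ent A = - \sum_j xlog2x (w j).
Proof.
move=> [Uu eA]; rewrite /ent; congr (- _).
case: closed_field_poly_normal => /= s.
rewrite (monicP (char_poly_monic A)) scale1r {1}eA char_poly_conj// char_poly_rdiag.
rewrite -(big_map (fun i => (w i)%:C%C) xpredT (fun z => 'X - z%:P)) => /esym es.
by rewrite (perm_big _ (prod_XsubC_eq es)) /= big_map.
Qed.

Lemma xlog2xE (r : R) : 0 <= r -> xlog2x r = r * ln r / ln 2.
Proof.
rewrite /xlog2x /log2 le_eqVlt => /predU1P[<-|->]; last by rewrite mulrA.
by rewrite ltxx !mul0r.
Qed.

Definition psd n (A : 'M[C]_n) :=
  A ^t* = A /\ forall v : 'rV[C]_n, 0 <= (v *m A *m v ^t*) 0 0.

Lemma eig_exists n (A : 'M[C]_n) : A ^t* = A -> exists U w, eigdec A U w.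
Proof.
move=> hA; have hA' : A \is hermsymmx by apply/is_hermitianmxP; rewrite expr0 scale1r hA.
have /orthomx_spectralP := hermitian_normalmx hA'.
have Uu := spectral_unitarymx A; rewrite (invmx_unitary Uu) => eA.
exists (spectralmx A), (fun j => complex.Re (spectral_diag A 0 j)); split=> //.
rewrite {1}eA; congr (_ *m diag_mx _ *m _); apply/rowP => j; rewrite !mxE RRe_real//.
by have /mxOverP := hermitian_spectral_diag_real hA'; apply.
Qed.

Lemma eigdecV n (A U : 'M[C]_n) w : eigdec A U w -> U *m A *m U ^t* = rdiag w.
Proof.
move=> [/unitarymxP Uu ->].
by rewrite !mulmxA Uu mul1mx -mulmxA Uu mulmx1.
Qed.

Lemma psd_eig_ge0 n (A U : 'M[C]_n) w j : psd A -> eigdec A U w -> 0 <= w j.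
Proof.
move=> [_ pA] /eigdecV e; have := pA (row j U).
have -> : (row j U *m A *m (row j U) ^t*) 0 0 = (U *m A *m U ^t*) j j.
  rewrite -row_mul !mxE; apply: eq_bigr => k _; by rewrite !mxE.
by rewrite e !mxE eqxx /= ler0c.
Qed.

Lemma ent_psd n (A U : 'M[C]_n) w : psd A -> eigdec A U w ->
  ent A = - (\sum_j w j * ln (w j)) / ln 2.
Proof.
move=> pA eA; rewrite (ent_eigdec eA) mulNr mulr_suml; congr (- _).
by apply: eq_bigr => j _; rewrite xlog2xE// (psd_eig_ge0 j pA eA).
Qed.

End Spec.

(** * Frobenius norms and squared overlaps of eigenbases *)

Section Fro.
Variable R : realType.
Notation C := R[i].

Definition fro m n (A : 'M[C]_(m, n)) : R := \sum_i \sum_j nsq (A i j).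

Lemma fro_ge0 m n (A : 'M[C]_(m, n)) : 0 <= fro A.
Proof. by apply: sumr_ge0 => i _; apply: sumr_ge0 => j _; apply: nsq_ge0. Qed.

Lemma mul_adj_diagE m n (A : 'M[C]_(m, n)) i :
  (A *m A ^t*) i i = (\sum_j nsq (A i j))%:C%C.
Proof.
by rewrite !mxE rmorph_sum /=; apply: eq_bigr => j _; rewrite !mxE nsqE.
Qed.

Lemma fro_trace m n (A : 'M[C]_(m, n)) : (fro A)%:C%C = \tr (A *m A ^t*).
Proof.
by rewrite /mxtrace rmorph_sum /=; apply: eq_bigr => i _; rewrite mul_adj_diagE.
Qed.

Lemma adjM m n p (A : 'M[C]_(m, n)) (B : 'M[C]_(n, p)) :
  (A *m B) ^t* = B ^t* *m A ^t*.
Proof. by rewrite trmx_mul map_mxM. Qed.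

Lemma fro_unitaryl m n (U : 'M[C]_m) (A : 'M[C]_(m, n)) :
  U \is unitarymx -> fro (U *m A) = fro A.
Proof.
move=> Uu; apply: (@complexI R); rewrite !fro_trace adjM mulmxA.
by rewrite mxtrace_mulC !mulmxA (unitary_adjl Uu) mul1mx.
Qed.

Lemma unitary_adj n (U : 'M[C]_n) : U \is unitarymx -> U ^t* \is unitarymx.
Proof. by rewrite trmxC_unitary. Qed.

Lemma fro_adj m n (A : 'M[C]_(m, n)) : fro (A ^t*) = fro A.
Proof.
rewrite /fro exchange_big; apply: eq_bigr => i _; apply: eq_bigr => j _.
by rewrite !mxE nsqJ.
Qed.

Lemma fro_conj m n (A : 'M[C]_(m, n)) : fro (map_mx Num.conj A) = fro A.
Proof. by apply: eq_bigr => i _; apply: eq_bigr => j _; rewrite !mxE nsqJ. Qed.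

Lemma fro_unitaryr m n (U : 'M[C]_n) (A : 'M[C]_(m, n)) :
  U \is unitarymx -> fro (A *m U) = fro A.
Proof.
by move=> Uu; rewrite -fro_adj adjM (fro_unitaryl _ (unitary_adj Uu)) fro_adj.
Qed.

Lemma fro_eq0 m n (A : 'M[C]_(m, n)) : fro A <= 0 -> A = 0.
Proof.
move=> A0; have {A0} /eqP : fro A = 0 by apply/le_anti; rewrite A0 fro_ge0.
rewrite psumr_eq0 => [|i _]; last by apply: sumr_ge0 => j _; apply: nsq_ge0.
move=> /allP A0; apply/matrixP => i j; rewrite mxE; apply/eqP.
have := A0 i (mem_index_enum _); rewrite psumr_eq0 => [|k _]; last exact: nsq_ge0.
by move=> /allP /(_ j (mem_index_enum _)); rewrite nsq_eq0.
Qed.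

Lemma rdiagM_gram m n (A : 'M[C]_(m, n)) p i :
  (A *m rdiag p *m A ^t*) i i = (\sum_a p a * nsq (A i a))%:C%C.
Proof.
rewrite mul_mx_diag !mxE rmorph_sum /=; apply: eq_bigr => a _.
by rewrite !mxE rmorphM /= nsqE mulrCA mulrA.
Qed.

Lemma rdiag_mull m n (p : 'I_m -> R) (A : 'M[C]_(m, n)) i j :
  (rdiag p *m A) i j = (p i)%:C%C * A i j.
Proof. by rewrite mul_diag_mx !mxE. Qed.

Lemma rdiag_mulr m n (p : 'I_n -> R) (A : 'M[C]_(m, n)) i j :
  (A *m rdiag p) i j = A i j * (p j)%:C%C.
Proof. by rewrite mul_mx_diag !mxE. Qed.

Lemma rdiag_adj n (p : 'I_n -> R) : (rdiag p) ^t* = rdiag p.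
Proof.
rewrite /rdiag tr_diag_mx map_diag_mx; congr diag_mx; apply/rowP => j.
by rewrite !mxE /= conjC_real.
Qed.

Lemma rdiagM n (p q : 'I_n -> R) : rdiag p *m rdiag q = rdiag (fun i => p i * q i).
Proof.
by rewrite /rdiag mulmx_diag; congr diag_mx; apply/rowP => j; rewrite !mxE rmorphM.
Qed.

Lemma eq_rdiag n (p q : 'I_n -> R) : p =1 q -> rdiag p = rdiag q.
Proof. by move=> e; congr diag_mx; apply/rowP => j; rewrite !mxE e. Qed.

Lemma unitary_colsum n (M : 'M[C]_n) b : M \is unitarymx -> \sum_a nsq (M b a) = 1.
Proof.
by move=> /unitarymxP /matrixP /(_ b b); rewrite mul_adj_diagE mxE eqxx => /(@complexI R).
Qed.

Lemma unitary_rowsum n (M : 'M[C]_n) a : M \is unitarymx -> \sum_b nsq (M b a) = 1.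
Proof.
rewrite -trmxC_unitary => /(@unitary_colsum _ _ a) <-.
by apply: eq_bigr => b _; rewrite !mxE nsqJ.
Qed.

Lemma unitary_overlap n (U V : 'M[C]_n) : U \is unitarymx -> V \is unitarymx ->
  U *m V ^t* \is unitarymx.
Proof. by move=> Uu Vu; exact: mul_unitarymx Uu (unitary_adj Vu). Qed.

Lemma wsum_diff m n (th : 'I_m -> 'I_n -> R) (F G : 'M[C]_(m, n)) t :
  (forall i j, `|th i j| <= 1) -> 0 < t ->
  `|\sum_i \sum_j th i j * nsq (F i j) - \sum_i \sum_j th i j * nsq (G i j)|
    <= fro (F - G) / (2 * t) + t * (fro F + fro G).
Proof.
move=> th1 t0; rewrite /fro -sumrB mulr_suml -big_split mulr_sumr -big_split /=.
apply: le_trans (ler_norm_sum _ _ _) _; apply: ler_sum => i _.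
rewrite -sumrB mulr_suml -big_split mulr_sumr -big_split /=.
apply: le_trans (ler_norm_sum _ _ _) _; apply: ler_sum => j _.
rewrite -mulrBr normrM; apply: le_trans (ler_piMl (normr_ge0 _) (th1 i j)) _.
by rewrite !mxE; exact: nsq_diff.
Qed.

Lemma eigdec_tr n (A U : 'M[C]_n) p : eigdec A U p -> \tr A = (\sum_a p a)%:C%C.
Proof.
move=> [Uu ->]; rewrite mxtrace_mulC mulmxA (unitarymxP Uu) mul1mx.
by rewrite mxtrace_diag rmorph_sum; apply: eq_bigr => i _; rewrite mxE.
Qed.

(* S(A || B) in nats, for A and B with eigenvalues p, q and eigenbases V, U: it is
   the classical relative entropy of the weights p_a |<b|a>|^2 and q_b |<b|a>|^2.
   Since ln 0 = 0 in the library, this is meaningful only when the weights of the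
   first kind vanish wherever q_b = 0. *)
Definition kl n (U V : 'M[C]_n) (p q : 'I_n -> R) : R :=
  \sum_b \sum_a p a * nsq ((U *m V ^t*) b a) * (ln (p a) - ln (q b)).

(** * Holevo information of an ensemble as an average relative entropy *)

Section Mixture.
Variables (n : nat) (I : finType) (c : I -> R) (A : I -> 'M[C]_n) (B : 'M[C]_n).
Variables (U : 'M[C]_n) (q : 'I_n -> R) (V : I -> 'M[C]_n) (p : I -> 'I_n -> R).
Hypotheses (eB : eigdec B U q) (eA : forall z, eigdec (A z) (V z) (p z)).
Hypothesis BA : B = \sum_z (c z)%:C%C *: A z.

Lemma mixture_eig b :
  q b = \sum_z c z * \sum_a p z a * nsq ((U *m (V z) ^t*) b a).
Proof.
have e : (U *m B *m U ^t*) b b = (q b)%:C%C by rewrite (eigdecV eB) !mxE eqxx.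
apply: (@complexI R); rewrite -e -!mulmxA BA mulmx_suml mulmx_sumr.
rewrite summxE rmorph_sum; apply: eq_bigr => z _ /=.
rewrite -scalemxAl -scalemxAr mxE rmorphM /=; congr (_ * _).
rewrite -rdiagM_gram adjM trmxCK; have [_ {1}->] := eA z.
by rewrite !mulmxA.
Qed.

Hypotheses (pA : forall z, psd (A z)) (pB : psd B).

(** A vanishing [q b] is a sum of nonnegative terms, so each component of positive weight is
    orthogonal to that eigenvector. This is the support condition that makes [kl] a relative
    entropy. *)
Lemma mixture_support z a b : (forall z, 0 <= c z) -> 0 < c z -> q b = 0 ->
  p z a * nsq ((U *m (V z) ^t*) b a) = 0.
Proof.
move=> c0 cz; rewrite mixture_eig => /eqP.
have p0 y d : 0 <= p y d by exact: psd_eig_ge0 (pA y) (eA y).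
rewrite psumr_eq0 => [/allP /(_ z (mem_index_enum _))|y _]; last first.
  by rewrite mulr_ge0// sumr_ge0// => d _; rewrite mulr_ge0// nsq_ge0.
rewrite mulf_eq0 gt_eqF//= psumr_eq0 => [|d _]; last by rewrite mulr_ge0// nsq_ge0.
by move=> /allP /(_ a (mem_index_enum _)) /eqP.
Qed.

(** By [mixture_eig] the cross terms in ln (q b) add up to the entropy of [B]. The weights are
    arbitrary reals, which also allows weights 1 for the sum of two unnormalised operators. *)
Lemma mixture_ent :
  \sum_z c z * kl U (V z) (p z) q = (ent B - \sum_z c z * ent (A z)) * ln 2.
Proof.
have l2 : ln 2 != 0 :> R by rewrite gt_eqF// ln_gt0// ltr1n.
have -> : \sum_z c z * ent (A z) = - (\sum_z c z * \sum_j p z j * ln (p z j)) / ln 2.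
  rewrite mulNr mulr_suml -sumrN; apply: eq_bigr => z _.
  by rewrite (ent_psd (pA z) (eA z)) !mulNr mulrN mulrA.
rewrite (ent_psd pB eB) !mulNr opprK mulrDl mulNr !divfK// addrC.
have -> : \sum_j q j * ln (q j) =
   \sum_z c z * \sum_b \sum_a p z a * nsq ((U *m (V z) ^t*) b a) * ln (q b).
  under eq_bigr do rewrite {1}mixture_eig mulr_suml.
  rewrite exchange_big; apply: eq_bigr => z _; rewrite mulr_sumr.
  by apply: eq_bigr => b _; rewrite -mulrA mulr_suml.
rewrite -sumrB; apply: eq_bigr => z _; rewrite -mulrBr; congr (_ * _).
have [Uu _] := eB; have [Vu _] := eA z.
have M1 a := unitary_rowsum a (unitary_overlap Uu Vu).
rewrite /kl; under eq_bigr do under eq_bigr do rewrite mulrBr.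
under eq_bigr do rewrite sumrB.
rewrite sumrB; congr (_ - _); rewrite exchange_big; apply: eq_bigr => a _ /=.
under eq_bigr do rewrite mulrAC.
by rewrite -mulr_sumr M1 mulr1.
Qed.

End Mixture.

End Fro.

(** * Relative entropy and a Pinsker inequality *)

Section Kl.
Variable R : realType.
Notation C := R[i].

Lemma ln_le_sub1 (x : R) : 0 < x -> ln x <= x - 1.
Proof.
by move=> x0; have := expR_ge1Dx (ln x); rewrite lnK// lerBrDl.
Qed.

Lemma lnB_le (p q : R) : 0 < p -> 0 < q -> ln q - ln p <= q / p - 1.
Proof. by move=> p0 q0; rewrite -ln_div ?posrE// ln_le_sub1// divr_gt0. Qed.

(** ln x <= x - 1 at x = s q / p; the scale [s] can be tuned to operators of different traces. *)
Lemma kl_term_ge (p q s : R) : 0 <= p -> 0 < q -> 0 < s ->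
  p - s * q + p * ln s <= p * (ln p - ln q).
Proof.
rewrite le_eqVlt => /predU1P[<- q0 s0|p0 q0 s0].
  by rewrite !mul0r sub0r addr0 oppr_le0 mulr_ge0// ltW.
have h : ln s + ln q - ln p <= s * q / p - 1.
  by rewrite -lnM ?posrE// lnB_le// mulr_gt0.
have := ler_wpM2l (ltW p0) h; rewrite [p * (s * q / p - 1)]mulrBr mulr1 mulrC.
have -> : p * (s * q / p) = s * q by rewrite mulrC divfK// gt_eqF.
lra.
Qed.

Lemma kl_term_le (p q : R) : 0 <= p -> 0 < q ->
  p * (ln p - ln q) <= p * (p / q - 1).
Proof.
rewrite le_eqVlt => /predU1P[<-|p0 q0]; first by rewrite !mul0r.
by rewrite ler_pM2l// lnB_le.
Qed.

(** ln x <= x - 1 at x = sqrt q / sqrt p, doubled. The Hellinger form is wanted because square roots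
    of eigenvalues are amplitudes, so that the left side sums to a Frobenius distance. *)
Lemma kl_term_hellinger (p q : R) : 0 <= p -> 0 < q ->
  (Num.sqrt p - Num.sqrt q) ^+ 2 + p - q <= p * (ln p - ln q).
Proof.
move=> p0 q0.
have -> : (Num.sqrt p - Num.sqrt q) ^+ 2 = p + q - 2 * (Num.sqrt p * Num.sqrt q).
  by rewrite sqrrB !sqr_sqrtr ?(ltW q0)//; ring.
have := p0; rewrite le_eqVlt => /predU1P[<-|{}p0].
  by rewrite sqrtr0 !mul0r; lra.
have sp : 0 < Num.sqrt p by rewrite sqrtr_gt0.
have sq : 0 < Num.sqrt q by rewrite sqrtr_gt0.
have e (x : R) : 0 < x -> ln x = 2 * ln (Num.sqrt x).
  by move=> x0; rewrite -[in LHS](sqr_sqrtr (ltW x0)) lnXn ?sqrtr_gt0// mulr_natl.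
rewrite (e p)// (e q)//.
have := ler_wpM2l (ltW p0) (lnB_le sp sq); rewrite [leRHS]mulrBr mulr1.
have -> : p * (Num.sqrt q / Num.sqrt p) = Num.sqrt p * Num.sqrt q.
  by rewrite -{1}(sqr_sqrtr (ltW p0)); field; rewrite gt_eqF.
lra.
Qed.

Section Overlap.
Variables (n : nat) (U V : 'M[C]_n) (p q : 'I_n -> R).
Hypotheses (Uu : U \is unitarymx) (Vu : V \is unitarymx).
Hypotheses (p0 : forall a, 0 <= p a) (q0 : forall b, 0 <= q b).
Local Notation M := (U *m V ^t*).
Hypothesis supp : forall a b, q b = 0 -> p a * nsq (M b a) = 0.

Lemma sum_overlap_p : \sum_b \sum_a p a * nsq (M b a) = \sum_a p a.
Proof.
rewrite exchange_big; apply: eq_bigr => a _ /=.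
by rewrite -mulr_sumr (unitary_rowsum a (unitary_overlap Uu Vu)) mulr1.
Qed.

Lemma sum_overlap_q : \sum_b \sum_a q b * nsq (M b a) = \sum_b q b.
Proof.
apply: eq_bigr => a _ /=.
by rewrite -mulr_sumr (unitary_colsum a (unitary_overlap Uu Vu)) mulr1.
Qed.

Lemma kl_ge s : 0 < s ->
  (1 + ln s) * \sum_a p a - s * \sum_b q b <= kl U V p q.
Proof.
move=> s0; rewrite -sum_overlap_p -sum_overlap_q /kl !mulr_sumr -sumrB.
apply: ler_sum => b _; rewrite !mulr_sumr -sumrB; apply: ler_sum => a _.
have := q0 b; rewrite le_eqVlt => /predU1P[/esym e|qb].
  by rewrite supp// e !(mul0r, mulr0) subrr.
rewrite mulrAC; apply: le_trans (ler_wpM2r (nsq_ge0 _) (kl_term_ge (p0 a) qb s0)).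
by rewrite le_eqVlt; apply/orP; left; apply/eqP; ring.
Qed.

(* In the bases V and U, the square roots of A and B have the matrices
   M sqrt(p) and sqrt(q) M. *)
Lemma kl_hellinger : \sum_a p a = \sum_b q b ->
  fro (M *m rdiag (fun a => Num.sqrt (p a)) - rdiag (fun b => Num.sqrt (q b)) *m M)
    <= kl U V p q.
Proof.
move=> epq.
have -> : kl U V p q = \sum_b \sum_a (p a * nsq (M b a) * (ln (p a) - ln (q b))
     - p a * nsq (M b a) + q b * nsq (M b a)).
  under [RHS]eq_bigr do rewrite big_split sumrB.
  by rewrite big_split sumrB /= sum_overlap_p sum_overlap_q epq subrK.
apply: ler_sum => b _; apply: ler_sum => a _.
rewrite mxE [X in nsq (_ + X)]mxE rdiag_mulr rdiag_mull [_%:C%C * _]mulrC -mulrBr -rmorphB.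
rewrite nsqM nsqR.
have := q0 b; rewrite le_eqVlt => /predU1P[/esym e|qb].
  rewrite supp// e sqrtr0 subr0 sqr_sqrtr// mul0r mulrC supp// oppr0 !mul0r. 
  by rewrite !addr0.
have := ler_wpM2r (nsq_ge0 (M b a)) (kl_term_hellinger (p0 a) qb).
by rewrite -subr_ge0 => h; rewrite -subr_ge0; apply: le_trans h _; rewrite le_eqVlt; apply/orP; left; apply/eqP; ring.
Qed.

End Overlap.

(* Expectation of the observable \sum_j z_j w_j^* w_j, where w_j is row j of W. *)
Definition readout n J (z : 'I_J -> R) (W : 'M[C]_(J, n)) (A : 'M[C]_n) : R :=
  \sum_j z j * complex.Re ((W *m A *m W ^t*) j j).

(* W W^* <= c, stated so as to apply directly to square roots of states. *)
Definition contr m n (c : R) (W : 'M[C]_(m, n)) :=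
  forall r (F : 'M[C]_(n, r)), fro (W *m F) <= c * fro F.

Lemma readout_gram n J r z (W : 'M[C]_(J, n)) (F : 'M[C]_(n, r)) :
  readout z W (F *m F ^t*) = \sum_j \sum_a z j * nsq ((W *m F) j a).
Proof.
apply: eq_bigr => j _; rewrite -mulr_sumr; congr (_ * _).
by rewrite mulmxA -(mulmxA _ (F ^t*)) -adjM mul_adj_diagE.
Qed.

Lemma le_sqr_of_amgm (y D : R) : 0 <= D ->
  (forall t, 0 < t -> y <= D / (2 * t) + 2 * t) -> 0 <= y -> y ^+ 2 <= 4 * D.
Proof.
move=> D0 h; rewrite le_eqVlt => /predU1P[<-|y0]; first by rewrite expr0n /= mulr_ge0.
(* At t = y / 4 the hypothesis reads y <= 2 D / y + y / 2. *)
have y4 : 0 < y / 4 by rewrite divr_gt0.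
have := h _ y4 => h1.
have : y * y <= y * (D / (2 * (y / 4)) + 2 * (y / 4)) by rewrite ler_pM2l.
have -> : y * (D / (2 * (y / 4)) + 2 * (y / 4)) = 2 * D + y ^+ 2 / 2.
  by field; rewrite gt_eqF.
rewrite -expr2; lra.
Qed.

Lemma eigdec_gram n (A U V : 'M[C]_n) p (f : 'I_n -> R) :
  U \is unitarymx -> eigdec A V p -> rdiag f *m rdiag f = rdiag p :> 'M[C]_n ->
  A = (U ^t* *m (U *m V ^t* *m rdiag f)) *m (U ^t* *m (U *m V ^t* *m rdiag f)) ^t*.
Proof.
move=> Uu [_ ->] ff; rewrite !mulmxA (unitary_adjl Uu) mul1mx.
by rewrite adjM trmxCK rdiag_adj -ff !mulmxA.
Qed.

Lemma eigdec_gramr n (B U M : 'M[C]_n) q (f : 'I_n -> R) :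
  M \is unitarymx -> eigdec B U q -> rdiag f *m rdiag f = rdiag q :> 'M[C]_n ->
  B = (U ^t* *m (rdiag f *m M)) *m (U ^t* *m (rdiag f *m M)) ^t*.
Proof.
move=> Mu [_ ->] ff; rewrite (adjM (U ^t*)) (adjM _ M) trmxCK rdiag_adj.
by rewrite -ff -!mulmxA; congr (_ *m (_ *m _)); rewrite !mulmxA (unitarymxP Mu) mul1mx.
Qed.

(** Both states are Gram matrices of square roots written in one pair of bases, at a distance
    controlled by [kl_hellinger]. Readouts are weighted sums of squared entries, so [wsum_diff]
    compares them; distance and norms each pick up a factor [c], hence c^2 after optimising. *)
Lemma pinsker n J (A B U V : 'M[C]_n) p q z (W : 'M[C]_(J, n)) c :
  psd A -> psd B -> \tr A = 1 -> \tr B = 1 -> eigdec A V p -> eigdec B U q ->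
  (forall a b, q b = 0 -> p a * nsq ((U *m V ^t*) b a) = 0) ->
  (forall j, `|z j| <= 1) -> 0 < c -> contr c W ->
  (readout z W A - readout z W B) ^+ 2 <= 4 * (c ^+ 2 * kl U V p q).
Proof.
move=> pA pB tA tB eA eB supp z1 c0 cW.
have p0 a : 0 <= p a := psd_eig_ge0 a pA eA.
have q0 b : 0 <= q b := psd_eig_ge0 b pB eB.
have [Vu _] := eA; have [Uu _] := eB.
have p1 : \sum_a p a = 1.
  by apply: (@complexI R); rewrite -(eigdec_tr eA) tA.
have q1 : \sum_a q a = 1.
  by apply: (@complexI R); rewrite -(eigdec_tr eB) tB.
have Mu := unitary_overlap Uu Vu.
set M := U *m V ^t* in supp Mu.
set X := M *m rdiag (fun a => Num.sqrt (p a)).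
set Y := rdiag (fun b => Num.sqrt (q b)) *m M.
have hD : fro (X - Y) <= kl U V p q by apply: kl_hellinger => //; rewrite p1 q1.
have sqrtK w : (forall a, 0 <= w a) ->
    rdiag (fun a => Num.sqrt (w a)) *m rdiag (fun a => Num.sqrt (w a)) = rdiag w :> 'M[C]_n.
  by move=> w0; rewrite rdiagM; apply: eq_rdiag => a; rewrite -expr2 sqr_sqrtr.
have UU := unitary_adjl Uu.
have AX : A = (U ^t* *m X) *m (U ^t* *m X) ^t*.
  exact: (eigdec_gram Uu eA (sqrtK _ p0)).
have BY : B = (U ^t* *m Y) *m (U ^t* *m Y) ^t*.
  exact: (eigdec_gramr Mu eB (sqrtK _ q0)).
have fX : fro X = 1.
  rewrite fro_unitaryl//; apply: (@complexI R); rewrite fro_trace rdiag_adj sqrtK//.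
  by rewrite mxtrace_diag -p1 rmorph_sum; apply: eq_bigr => i _; rewrite mxE.
have fY : fro Y = 1.
  rewrite fro_unitaryr//; apply: (@complexI R); rewrite fro_trace rdiag_adj sqrtK//.
  by rewrite mxtrace_diag -q1 rmorph_sum; apply: eq_bigr => i _; rewrite mxE.
have Uu' := unitary_adj Uu.
move: X Y hD AX BY fX fY => X Y hD AX BY fX fY.
rewrite -real_normK ?num_real//.
apply: le_trans (_ : 4 * (c ^+ 2 * fro (X - Y)) <= _); last first.
  by rewrite ler_pM2l// ler_wpM2l// sqr_ge0.
apply: le_sqr_of_amgm => // [|t t0]; first by rewrite mulr_ge0 ?sqr_ge0 ?fro_ge0.
(* With t / c as weight, the distance term becomes c^2 D / (2 t) and the norm terms 2 t, as
   [le_sqr_of_amgm] expects. *)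
have tc : 0 < t / c by rewrite divr_gt0.
have vA : readout z W A = \sum_j \sum_a z j * nsq ((W *m (U ^t* *m X)) j a).
  by rewrite -readout_gram -AX.
have vB : readout z W B = \sum_j \sum_a z j * nsq ((W *m (U ^t* *m Y)) j a).
  by rewrite -readout_gram -BY.
have := wsum_diff (W *m (U ^t* *m X)) (W *m (U ^t* *m Y)) (fun j _ => z1 j) tc.
rewrite -vA -vB -mulmxBr -mulmxBr.
move: (cW _ (U ^t* *m (X - Y))) (cW _ (U ^t* *m X)) (cW _ (U ^t* *m Y)).
rewrite (fro_unitaryl (X - Y) Uu') (fro_unitaryl X Uu') (fro_unitaryl Y Uu') fX fY.
move: (fro (X - Y)) (fro (W *m _)) (fro (W *m _)) (fro (W *m _)) (`|_|) => D f1 f2 f3 y.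
rewrite mulr1 => h1 h2 h3 hy; apply: le_trans hy _.
have -> : c ^+ 2 * D / (2 * t) = c * D / (2 * (t / c)).
  by field; rewrite !gt_eqF.
apply: lerD; first by rewrite ler_wpM2r// invr_ge0 mulr_ge0 ?ltW.
rewrite (_ : 2 * t = t / c * (c + c)); last by field; rewrite gt_eqF.
by rewrite ler_wpM2l ?(ltW tc)// lerD.
Qed.

End Kl.

(** * Information about each of n uniform bits *)

Section Chain.
Variable R : realType.
Notation C := R[i].

Definition avg (T : finType) (f : T -> R) : R := #|T|%:R^-1 * \sum_t f t.

Definition mxavg (T : finType) n (f : T -> 'M[C]_n) : 'M[C]_n :=
  \sum_t (#|T|%:R^-1 : R)%:C%C *: f t.

Lemma cardR_neq0 (T : finType) (t : T) : #|T|%:R != 0 :> R.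
Proof. by rewrite pnatr_eq0 -lt0n; apply/card_gt0P; exists t. Qed.

Lemma avg_const (T : finType) (t0 : T) (r : R) : avg (fun _ : T => r) = r.
Proof. by rewrite /avg sumr_const -[X in _ * X]mulr_natl mulKf// (cardR_neq0 t0). Qed.

Lemma eq_avg (T : finType) (f g : T -> R) : f =1 g -> avg f = avg g.
Proof. by move=> e; rewrite /avg; congr (_ * _); apply: eq_bigr. Qed.

Lemma ler_avg (T : finType) (f g : T -> R) : (forall t, f t <= g t) -> avg f <= avg g.
Proof. by move=> e; rewrite ler_wpM2l ?invr_ge0// ler_sum. Qed.

Lemma avgD (T : finType) (f g : T -> R) : avg (fun t => f t + g t) = avg f + avg g.
Proof. by rewrite /avg big_split mulrDr. Qed.

Lemma avgZ (T : finType) (a : R) (f : T -> R) : avg (fun t => a * f t) = a * avg f.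
Proof. by rewrite /avg -mulr_sumr mulrCA. Qed.

Lemma avgB (T : finType) (f g : T -> R) : avg (fun t => f t - g t) = avg f - avg g.
Proof. by rewrite /avg sumrB mulrBr. Qed.

Lemma avg_lin (T : finType) (a b : R) (f g h : T -> R) :
  avg (fun t => a * (f t + g t) + b * h t) = a * (avg f + avg g) + b * avg h.
Proof. by rewrite avgD !avgZ avgD. Qed.

Lemma avg_reindex (T : finType) (h : T -> T) (f : T -> R) :
  involutive h -> avg f = avg (fun t => f (h t)).
Proof. by move=> hK; rewrite /avg (reindex_inj (inv_inj hK)). Qed.

Lemma mxavg_reindex (T : finType) n (h : T -> T) (f : T -> 'M[C]_n) :
  involutive h -> mxavg f = mxavg (fun t => f (h t)).
Proof. by move=> hK; rewrite /mxavg (reindex_inj (inv_inj hK)). Qed.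

Lemma eq_mxavg (T : finType) n (f g : T -> 'M[C]_n) : f =1 g -> mxavg f = mxavg g.
Proof. by move=> e; apply: eq_bigr => t _; rewrite e. Qed.

Lemma mxavgD (T : finType) n (f g : T -> 'M[C]_n) :
  mxavg (fun t => f t + g t) = mxavg f + mxavg g.
Proof. by rewrite /mxavg -big_split; apply: eq_bigr => t _; rewrite scalerDr. Qed.

Lemma mxavg_const (T : finType) n (t0 : T) (A : 'M[C]_n) : mxavg (fun _ : T => A) = A.
Proof.
rewrite /mxavg -scaler_suml -rmorph_sum /= sumr_const -[X in X%:C%C]mulr_natl.
by rewrite mulfV ?(cardR_neq0 t0)// scale1r.
Qed.

Lemma avg_sqr_le (T : finType) (t0 : T) (f : T -> R) :
  avg f ^+ 2 <= avg (fun t => f t ^+ 2).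
Proof.
rewrite -subr_ge0; set m := avg f.
have <- : avg (fun t => (f t - m) ^+ 2) = avg (fun t => f t ^+ 2) - m ^+ 2.
  transitivity (avg (fun t => f t ^+ 2 + ((- 2 * m) * f t + m ^+ 2))).
    by apply: eq_avg => t; ring.
  by rewrite !avgD avgZ (avg_const t0) -/m; ring.
by rewrite mulr_ge0 ?invr_ge0// sumr_ge0// => t _; rewrite sqr_ge0.
Qed.

Lemma psd_comb (T : finType) n (c : T -> R) (f : T -> 'M[C]_n) :
  (forall t, 0 <= c t) -> (forall t, psd (f t)) -> psd (\sum_t (c t)%:C%C *: f t).
Proof.
move=> c0 pf; split=> [|v].
  rewrite linear_sum map_mx_sum; apply: eq_bigr => t _.
  by rewrite linearZ map_mxZ /= conjC_real; have [->] := pf t.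
rewrite mulmx_sumr mulmx_suml summxE sumr_ge0// => t _.
rewrite -scalemxAr -scalemxAl mxE mulr_ge0 ?ler0c//; by have [_] := pf t.
Qed.

Lemma readout_comb (T : finType) n J z (W : 'M[C]_(J, n)) (c : T -> R) (f : T -> 'M[C]_n) :
  readout z W (\sum_t (c t)%:C%C *: f t) = \sum_t c t * readout z W (f t).
Proof.
rewrite /readout; under [RHS]eq_bigr do rewrite mulr_sumr.
rewrite exchange_big; apply: eq_bigr => j _ /=.
rewrite mulmx_sumr mulmx_suml summxE (raddf_sum (@complex.Re R)) mulr_sumr /=.
apply: eq_bigr => t _; rewrite -scalemxAr -scalemxAl mxE mulrCA; congr (_ * _).
by case: (_ j j) => a b /=; rewrite mul0r subr0.
Qed.

Definition density n (A : 'M[C]_n) := psd A /\ \tr A = 1.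

Lemma density_mxavg (T : finType) (t0 : T) n (f : T -> 'M[C]_n) :
  (forall t, density (f t)) -> density (mxavg f).
Proof.
move=> df; split; first by apply: psd_comb => t; [rewrite invr_ge0|have [] := df t].
have -> : \tr (mxavg f) = \tr (mxavg (fun _ : T => f t0)).
  rewrite /mxavg !linear_sum; apply: eq_bigr => t _; rewrite !linearZ /=.
  by have [_ ->] := df t; have [_ ->] := df t0.
by rewrite mxavg_const//; have [_ ->] := df t0.
Qed.

Lemma readout_mxavg (T : finType) n J z (W : 'M[C]_(J, n)) (f : T -> 'M[C]_n) :
  readout z W (mxavg f) = avg (fun t => readout z W (f t)).
Proof. by rewrite readout_comb -mulr_sumr. Qed.

Lemma ln2_gt0 : 0 < ln 2 :> R.
Proof. by rewrite ln_gt0// ltr1n. Qed.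

Lemma two_point_arith (k0 k1 v0 v1 H H0 H1 l c : R) : 0 < l -> 0 < c ->
  2%:R^-1 * k0 + 2%:R^-1 * k1 = (H - (2%:R^-1 * H0 + 2%:R^-1 * H1)) * l ->
  (v1 - 2%:R^-1 * (v0 + v1)) ^+ 2 <= 4 * (c ^+ 2 * k1) ->
  (v0 - 2%:R^-1 * (v0 + v1)) ^+ 2 <= 4 * (c ^+ 2 * k0) ->
  2%:R^-1 * (H0 + H1) + (v0 - v1) ^+ 2 / (16 * c ^+ 2 * l) <= H.
Proof.
move=> l0 c0 E; have c2 : 0 < c ^+ 2 by rewrite exprn_gt0.
have -> : (v1 - 2%:R^-1 * (v0 + v1)) ^+ 2 = (v0 - v1) ^+ 2 / 4 by field.
have -> : (v0 - 2%:R^-1 * (v0 + v1)) ^+ 2 = (v0 - v1) ^+ 2 / 4 by field.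
have -> : (v0 - v1) ^+ 2 / (16 * c ^+ 2 * l) = (v0 - v1) ^+ 2 / 4 / c ^+ 2 / 4 / l.
  by field; rewrite !gt_eqF.
move: (_ ^+ 2 / 4) => y h0 h1.
have hy : y / c ^+ 2 <= 4 * (2^-1 * k0 + 2^-1 * k1).
  rewrite ler_pdivrMr//; move: h0 h1; move: (c ^+ 2) => d; lra.
rewrite -lerBrDl ler_pdivrMr// mulrDr -E; lra.
Qed.

(** Each state's readout is half the gap away from that of the average state. Squaring the half
    gives 4, Pinsker another 4, hence 16; ln 2 converts nats to bits. *)
Lemma two_point n J (s : bool -> 'M[C]_n) z (W : 'M[C]_(J, n)) c :
  (forall b, density (s b)) -> (forall j, `|z j| <= 1) -> 0 < c -> contr c W ->
  avg (fun b => ent (s b)) + (readout z W (s true) - readout z W (s false)) ^+ 2 / (16 * c ^+ 2 * ln 2)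
    <= ent (mxavg s).
Proof.
move=> ds z1 c0 cW.
have pd b : psd (s b) by have [] := ds b.
have [pB tB] := density_mxavg true ds.
have [U [q eB]] := eig_exists (proj1 pB).
have [V0 [p0 e0]] := eig_exists (proj1 (pd true)).
have [V1 [p1 e1]] := eig_exists (proj1 (pd false)).
pose V b := if b then V0 else V1; pose p b := if b then p0 else p1.
have eA b : eigdec (s b) (V b) (p b) by case: b.
have h2 : 0 < #|{: bool}|%:R^-1 :> R by rewrite card_bool invr_gt0.
have := mixture_ent eB eA (erefl _) pd pB => /= E.
have K b : (readout z W (s b) - readout z W (mxavg s)) ^+ 2 <= 4 * (c ^+ 2 * kl U (V b) (p b) q).
  apply: (pinsker _ pB _ tB (eA b) eB) => //; first by have [] := ds b.
  move=> a d; apply: (mixture_support eB eA _ pd) => //= y; exact: ltW.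
have := K true; have := K false; move: E.
rewrite readout_mxavg /avg !big_bool !card_bool.
exact: two_point_arith ln2_gt0 c0.
Qed.

Lemma sum_drop (F : nat -> R) m : F 0%N - F m = \sum_(j < m) (F j - F j.+1).
Proof.
elim: m => [|m IH]; first by rewrite big_ord0 subrr.
by rewrite big_ord_recr -IH /= addrA subrK.
Qed.

(** * Revealing the bits of x one at a time *)

Section Bits.
Variable n : nat.
Notation X := {ffun 'I_n -> bool}.

Definition merge (j : nat) (x y : X) : X := [ffun k : 'I_n => if (k < j)%N then x k else y k].
Definition flip (j : 'I_n) (x : X) : X := [ffun k : 'I_n => if k == j then ~~ x k else x k].

Lemma flipK j : involutive (flip j).
Proof. by move=> x; apply/ffunP => k; rewrite !ffunE; case: eqP; rewrite ?negbK. Qed.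

(** Exchanging the tails of two independent strings is an involution on pairs, so the merged string
    is again uniform. *)
Lemma avg_merge j (g : X -> R) : avg (fun x => avg (fun y => g (merge j x y))) = avg g.
Proof.
have x0 : X := [ffun=> false].
rewrite /avg -mulr_sumr pair_big /=.
pose h (u : X * X) := (merge j u.1 u.2, merge j u.2 u.1).
have hK : involutive h.
  by move=> [x y]; rewrite /h /=; congr pair; apply/ffunP => k; rewrite !ffunE; case: (k < j)%N.
have -> : \sum_u g (merge j u.1 u.2) = \sum_(u : X * X) g u.1.
  by rewrite [RHS](reindex_inj (inv_inj hK)).
rewrite -(pair_big xpredT xpredT (fun x (y : X) => g x)) /=.
congr (_ * _); rewrite -[RHS](mulKf (cardR_neq0 x0)); congr (_ * _).
by rewrite mulr_sumr; apply: eq_bigr => x _; rewrite sumr_const mulr_natl.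
Qed.

Definition sgb (b : bool) : R := (-1) ^+ b.

Lemma avg_flip_le (j : 'I_n) (f g w : X -> R) K :
  (forall x, 2^-1 * (f x + f (flip j x)) + K * w x <= g x) ->
  avg f + K * avg w <= avg g.
Proof.
move=> /ler_avg; rewrite avg_lin -(avg_reindex f (flipK j)).
by apply: le_trans; rewrite lerD2r; move: (avg f) => y; lra.
Qed.

(** Flipping bit [j] reverses its sign, so the signed difference averages to twice the correlation;
    convexity of the square does the rest. *)
Lemma avg_flip_sqr (j : 'I_n) (v : X -> R) :
  4 * avg (fun x : X => sgb (x j) * v x) ^+ 2 <=
  avg (fun x => (v x - v (flip j x)) ^+ 2).
Proof.
have x0 : X := [ffun=> false].
have e : avg (fun x : X => sgb (x j) * (v x - v (flip j x))) =
    2 * avg (fun x : X => sgb (x j) * v x).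
  rewrite (eq_avg (fun x : X => mulrBr (sgb (x j)) (v x) (v (flip j x)))) avgB.
  rewrite [X in _ - X](avg_reindex _ (flipK j)).
  rewrite [X in _ - X](_ : _ = - avg (fun x : X => sgb (x j) * v x)) ?opprK; first by ring.
  rewrite -mulN1r -avgZ; apply: eq_avg => x; rewrite flipK ffunE eqxx mulN1r -mulNr.
  by congr (_ * _); rewrite /sgb signrN.
have := avg_sqr_le x0 (fun x : X => sgb (x j) * (v x - v (flip j x))).
rewrite e exprMn (_ : 2 ^+ 2 = 4); last by ring.
suff -> : avg (fun x : X => (sgb (x j) * (v x - v (flip j x))) ^+ 2) =
    avg (fun x : X => (v x - v (flip j x)) ^+ 2) by [].
by apply: eq_avg => x; rewrite exprMn /sgb sqrr_sign mul1r.
Qed.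

Variables (d : nat) (s : X -> 'M[C]_d).
Hypothesis ds : forall x, density (s x).
(* The state of the system once only the first j bits of x are known. *)
Let tau j x := mxavg (fun y => s (merge j x y)).

Lemma tau_split (j : 'I_n) x : tau j x = mxavg (fun b : bool => tau j.+1 (if b then x else flip j x)).
Proof.
rewrite {1}/mxavg big_bool card_bool /= -scalerDr /tau -mxavgD.
(* For each y both sides have the same two summands, in an order that depends on whether [x j] and
   [y j] agree. *)
have -> : mxavg (fun y => s (merge j.+1 x y) + s (merge j.+1 (flip j x) y)) =
   mxavg (fun y => s (merge j x y) + s (merge j x (flip j y))).
  apply: eq_mxavg => y; have [xy|xy] := eqVneq (x j) (y j); last rewrite addrC;
    congr (s _ + s _); apply/ffunP => k; rewrite !ffunE ltnS leq_eqVlt;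
    case: (eqVneq k j) => [->|kj]; rewrite ?eqxx ?ltnn ?(inj_eq val_inj) ?(negbTE kj) ?xy //=;
    by case: (x j) (y j) xy => [] [].
rewrite mxavgD -(mxavg_reindex (fun y => s (merge j x y)) (flipK j)) -mulr2n.
rewrite -scalerMnr scalerMnl -rmorphMn /= -[X in X%:C%C]mulr_natr.
by rewrite mulVf ?scale1r// pnatr_eq0.
Qed.

Lemma chain_step J (z : 'I_J -> R) (W : 'M[C]_(J, d)) c (j : 'I_n) :
  (forall i, `|z i| <= 1) -> 0 < c -> contr c W ->
  avg (fun x => ent (tau j.+1 x)) + avg (fun x : X => sgb (x j) * readout z W (s x)) ^+ 2 / (4 * c ^+ 2 * ln 2)
  <= avg (fun x => ent (tau j x)).
Proof.
move=> z1 c0 cW.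
have x0 : X := [ffun=> false].
have dt i x : density (tau i x) by apply: (density_mxavg x0) => y; apply: ds.
set v := fun x => readout z W (tau j.+1 x).
have l2 := ln2_gt0.
have c2 : 0 < c ^+ 2 by rewrite exprn_gt0.
have step x : 2^-1 * (ent (tau j.+1 x) + ent (tau j.+1 (flip j x)))
    + (16 * c ^+ 2 * ln 2)^-1 * (v x - v (flip j x)) ^+ 2 <= ent (tau j x).
  rewrite [in leRHS]tau_split.
  have := @two_point d J (fun b => tau j.+1 (if b then x else flip j x)) z W c _ z1 c0 cW.
  rewrite /avg big_bool card_bool /= => /(_ (fun b => dt _ _)).
  by rewrite [X in _ + X <= _]mulrC.
(* Bit [j] is among the first j + 1, so its sign is unaffected by averaging over the later bits, and
   [s] may be replaced by [tau j.+1]. *)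
rewrite (_ : avg (fun x : X => sgb (x j) * readout z W (s x)) = avg (fun x : X => sgb (x j) * v x)).
  apply: le_trans (avg_flip_le step); rewrite lerD2l [leLHS]mulrC.
  rewrite (_ : (4 * c ^+ 2 * ln 2)^-1 = (16 * c ^+ 2 * ln 2)^-1 * 4); last first.
    by field; rewrite !gt_eqF.
  rewrite -[leLHS]mulrA ler_wpM2l ?avg_flip_sqr// invr_ge0 ltW//.
  by rewrite !mulr_gt0.
rewrite -(avg_merge j.+1); apply: eq_avg => x.
rewrite /v readout_mxavg -avgZ; apply: eq_avg => y; by rewrite ffunE ltnSn.
Qed.

(** The entropies of [tau] telescope from the overall average at 0 to the individual states at n.
    The observable may change with the bit, so no single measurement has to learn all of x. *)
Lemma chain (J : nat) (z : 'I_n -> 'I_J -> R) (W : 'I_n -> 'M[C]_(J, d)) c :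
  (forall j i, `|z j i| <= 1) -> 0 < c -> (forall j, contr c (W j)) ->
  \sum_j avg (fun x : X => sgb (x j) * readout (z j) (W j) (s x)) ^+ 2 / (4 * c ^+ 2 * ln 2)
   <= ent (mxavg s) - avg (fun x => ent (s x)).
Proof.
move=> z1 c0 cW.
have x0 : X := [ffun=> false].
pose F k := avg (fun x => ent (tau k x)).
have -> : ent (mxavg s) = F 0%N.
  rewrite /F -[LHS](avg_const x0); apply: eq_avg => x; congr ent.
  by apply: eq_mxavg => y; congr s; apply/ffunP => k; rewrite ffunE.
have -> : avg (fun x => ent (s x)) = F n.
  apply: eq_avg => x; congr ent; rewrite -[LHS](mxavg_const x0).
  by apply: eq_mxavg => y; congr s; apply/ffunP => k; rewrite ffunE ltn_ord.
rewrite sum_drop.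
apply: ler_sum => j _; rewrite lerBrDl; exact: chain_step.
Qed.

End Bits.
End Chain.

(** * Adjoining a classical bit *)

Section Block.
Variable R : realType.
Notation C := R[i].

(* blk A0 A1 is the state A0 + A1 together with a classical bit telling which summand. *)
Definition blk m n (A0 A1 : 'M[C]_(m, n)) : 'M[C]_(m + m, n + n) := block_mx A0 0 0 A1.

Lemma blkM m n p (A0 A1 : 'M[C]_(m, n)) (B0 B1 : 'M[C]_(n, p)) :
  blk A0 A1 *m blk B0 B1 = blk (A0 *m B0) (A1 *m B1).
Proof. by rewrite mulmx_block !mul0mx !mulmx0 !addr0 !add0r. Qed.

Lemma blk_adj m n (A0 A1 : 'M[C]_(m, n)) : (blk A0 A1) ^t* = blk (A0 ^t*) (A1 ^t*).
Proof. by rewrite /blk tr_block_mx map_block_mx !trmx0 !map_mx0. Qed.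

Definition blkw m T (w0 w1 : 'I_m -> T) (i : 'I_(m + m)) : T :=
  match split i with inl a => w0 a | inr a => w1 a end.

Lemma blk_rdiag m (w0 w1 : 'I_m -> R) : rdiag (blkw w0 w1) = blk (rdiag w0) (rdiag w1).
Proof.
rewrite /rdiag /blk -diag_mx_row; congr diag_mx.
by apply/rowP => i; rewrite !mxE /blkw; case: split => a; rewrite mxE.
Qed.

Lemma sum_blkw m (w0 w1 : 'I_m -> R) (f : R -> R) :
  \sum_i f (blkw w0 w1 i) = \sum_a f (w0 a) + \sum_a f (w1 a).
Proof.
by rewrite big_split_ord; congr (_ + _); apply: eq_bigr => a _; rewrite /blkw;
  [rewrite (unsplitK (inl a))|rewrite (unsplitK (inr a))].
Qed.

Lemma eigdec_blk m (A0 A1 U0 U1 : 'M[C]_m) w0 w1 :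
  eigdec A0 U0 w0 -> eigdec A1 U1 w1 -> eigdec (blk A0 A1) (blk U0 U1) (blkw w0 w1).
Proof.
move=> [/unitarymxP u0 ->] [/unitarymxP u1 ->]; split.
  by apply/unitarymxP; rewrite blk_adj blkM u0 u1 /blk -scalar_mx_block.
by rewrite blk_adj blk_rdiag !blkM.
Qed.

Lemma psd_blk m (A0 A1 : 'M[C]_m) : psd A0 -> psd A1 -> psd (blk A0 A1).
Proof.
move=> [h0 p0] [h1 p1]; split=> [|v]; first by rewrite blk_adj h0 h1.
rewrite -[v]hsubmxK mul_row_block !mulmx0 addr0 add0r tr_row_mx map_col_mx mul_row_col mxE.
by rewrite addr_ge0.
Qed.

Lemma ent_blk m (A0 A1 : 'M[C]_m) : psd A0 -> psd A1 -> ent (blk A0 A1) = ent A0 + ent A1.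
Proof.
move=> p0 p1; have [U0 [w0 e0]] := eig_exists (proj1 p0).
have [U1 [w1 e1]] := eig_exists (proj1 p1).
rewrite (ent_eigdec (eigdec_blk e0 e1)) (ent_eigdec e0) (ent_eigdec e1).
by rewrite (sum_blkw _ _ (@xlog2x R)) opprD.
Qed.

Lemma tr_blk m (A0 A1 : 'M[C]_m) : \tr (blk A0 A1) = \tr A0 + \tr A1.
Proof. exact: mxtrace_block. Qed.

Lemma psd_add m (A0 A1 : 'M[C]_m) : psd A0 -> psd A1 -> psd (A0 + A1).
Proof.
move=> [h0 p0] [h1 p1]; split=> [|v]; first by rewrite linearD map_mxD h0 h1.
by rewrite mulmxDr mulmxDl mxE addr_ge0.
Qed.

Lemma sum_bool1 (f : bool -> R) : \sum_b 1 * f b = f false + f true.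
Proof. by rewrite big_bool !mul1r addrC. Qed.

Section Sum.
Variables (n : nat) (A0 A1 : 'M[C]_n).
Hypotheses (pA0 : psd A0) (pA1 : psd A1).
Let A (b : bool) := if b then A1 else A0.
Let pA b : psd (A b) := match b return psd (A b) with true => pA1 | false => pA0 end.

Lemma sum_eig : exists U q (V : bool -> 'M[C]_n) p,
  [/\ eigdec (A0 + A1) U q, forall b, eigdec (A b) (V b) (p b) &
   \sum_(b : bool) kl U (V b) (p b) q = (ent (A0 + A1) - ent (blk A0 A1)) * ln 2].
Proof.
have pB := psd_add pA0 pA1.
have [U [q eB]] := eig_exists (proj1 pB).
have [V0 [p0 e0]] := eig_exists (proj1 pA0).
have [V1 [p1 e1]] := eig_exists (proj1 pA1).
pose V b := if b then V1 else V0; pose p b := if b then p1 else p0.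
have eA b : eigdec (A b) (V b) (p b) by case: b.
exists U, q, V, p; split=> //.
have e : A0 + A1 = \sum_(b : bool) (1 : R)%:C%C *: A b.
  by rewrite big_bool /= !scale1r addrC.
have h := mixture_ent eB eA e pA pB.
have k1 : \sum_b (1 : R) * ent (A b) = ent (blk A0 A1).
  exact: etrans (sum_bool1 (fun b => ent (A b))) (esym (ent_blk pA0 pA1)).
have k2 : \sum_b kl U (V b) (p b) q = \sum_b (1 : R) * kl U (V b) (p b) q.
  by apply: eq_bigr => b _; rewrite mul1r.
exact: etrans k2 (etrans h (congr1 (fun x => (_ - x) * _) k1)).
Qed.

Lemma sum_supp U q (V : bool -> 'M[C]_n) p :
  eigdec (A0 + A1) U q -> (forall b, eigdec (A b) (V b) (p b)) ->
  forall b a d, q d = 0 -> p b a * nsq ((U *m (V b) ^t*) d a) = 0.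
Proof.
move=> eB eA b a d.
have e : A0 + A1 = \sum_(b : bool) (1 : R)%:C%C *: A b.
  by rewrite big_bool /= !scale1r addrC.
exact: (mixture_support eB eA e pA).
Qed.

(** The two bounds [kl_ge] add up to 1 + ln s - 2 s, since the traces of the summands add up to 1.
    This is largest at s = 1/2, with value - ln 2, that is, minus one bit. *)
Lemma ent_blk_le : \tr (A0 + A1) = 1 -> ent (blk A0 A1) <= ent (A0 + A1) + 1.
Proof.
move=> t1; have [U [q [V [p [eB eA E]]]]] := sum_eig.
have l2 := ln2_gt0 R.
have p0 b a : 0 <= p b a := psd_eig_ge0 a (pA b) (eA b).
have q0 a : 0 <= q a := psd_eig_ge0 a (psd_add pA0 pA1) eB.
have q1 : \sum_a q a = 1.
  by apply: (@complexI R); rewrite -(eigdec_tr eB) t1.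
have tp : \sum_a p true a + \sum_a p false a = 1.
  apply: (@complexI R); rewrite rmorphD /= -(eigdec_tr (eA true)) -(eigdec_tr (eA false)).
  by rewrite addrC -mxtraceD.
have h2 : 0 < 2^-1 :> R by rewrite invr_gt0.
have K b := kl_ge (proj1 eB) (proj1 (eA b)) (p0 b) q0 (sum_supp eB eA b) h2.
have := lerD (K true) (K false).
rewrite [X in _ <= X -> _](_ : _ = \sum_b kl U (V b) (p b) q); last by rewrite big_bool.
rewrite E q1 lnV ?posrE//.
move: (ent _) (ent _) (ln 2) l2 (\sum_a p true a) (\sum_a p false a) tp => H1 H2 l l2 x y xy.
have -> : y = 1 - x by rewrite -xy addrAC subrr add0r.
move=> h; rewrite -(ler_pM2r l2).
lra.
Qed.

(* p_a |a><a| <= A0 + A1, tested on the vector (A0 + A1)^-1 |a>. *)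
Lemma eig_overlap_le1 U q (V : bool -> 'M[C]_n) p :
  eigdec (A0 + A1) U q -> (forall b, eigdec (A b) (V b) (p b)) ->
  forall b a, p b a * (\sum_d nsq ((U *m (V b) ^t*) d a) / q d) <= 1.
Proof.
move=> eB eA b a; set M := U *m _; set t := \sum_d _.
have p0 c : 0 <= p b c := psd_eig_ge0 c (pA b) (eA b).
have q0 d : 0 <= q d := psd_eig_ge0 d (psd_add pA0 pA1) eB.
have t0 : 0 <= t by apply: sumr_ge0 => d _; rewrite divr_ge0 ?nsq_ge0.
pose y : 'rV[C]_n := \row_d ((M d a)^* * (q d)^-1%:C%C).
have yM : (y *m M) 0 a = t%:C%C.
  rewrite !mxE rmorph_sum; apply: eq_bigr => d _ /=.
  by rewrite !mxE rmorphM /= nsqE mulrAC [_^* * _]mulrC.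
have h1 : ((y *m U) *m (A0 + A1) *m (y *m U) ^t*) 0 0 = t%:C%C.
  have -> : (y *m U) *m (A0 + A1) *m (y *m U) ^t* = y *m (U *m (A0 + A1) *m U ^t*) *m y ^t*.
    by rewrite adjM !mulmxA.
  rewrite (eigdecV eB).
  rewrite rdiagM_gram; congr (_%:C%C); apply: eq_bigr => d _.
  rewrite mxE nsqM nsqJ nsqR expr2 mulrCA; congr (_ * _).
  have [->|qd] := eqVneq (q d) 0; first by rewrite invr0 !mul0r.
  by rewrite mulrA mulfV// mul1r.
have h2 : ((y *m U) *m (A b) *m (y *m U) ^t*) 0 0 =
    (\sum_c p b c * nsq ((y *m M) 0 c))%:C%C.
  have [_ {1}->] := eA b; rewrite -rdiagM_gram; congr (_ 0 0).
  by rewrite !adjM trmxCK !mulmxA.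
have h3 : ((y *m U) *m (A b) *m (y *m U) ^t*) 0 0 <=
     ((y *m U) *m (A0 + A1) *m (y *m U) ^t*) 0 0.
  rewrite -subr_ge0; have -> : A0 + A1 = A b + A (~~ b) by case: (b); rewrite // addrC.
  by rewrite mulmxDr mulmxDl [X in X - _]mxE addrAC subrr add0r; have [_] := pA (~~ b).
move: h3; rewrite h1 h2 lecR => h3.
have {h3} : p b a * t ^+ 2 <= t.
  apply: le_trans h3; rewrite (bigD1 a)//= yM nsqR lerDl.
  by apply: sumr_ge0 => c _; rewrite mulr_ge0// nsq_ge0.
move: t0; rewrite le_eqVlt => /predU1P[<-|tt]; first by rewrite mulr0.
by rewrite expr2 mulrA -{3}[t]mul1r ler_pM2r.
Qed.

(** ln x <= x - 1 bounds each relative entropy by a chi-square type sum, which [eig_overlap_le1]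
    makes nonpositive. This stands in for operator monotonicity of the logarithm. *)
Lemma ent_blk_ge : ent (A0 + A1) <= ent (blk A0 A1).
Proof.
have [U [q [V [p [eB eA E]]]]] := sum_eig.
have l2 := ln2_gt0 R.
have p0 b a : 0 <= p b a := psd_eig_ge0 a (pA b) (eA b).
have q0 a : 0 <= q a := psd_eig_ge0 a (psd_add pA0 pA1) eB.
rewrite -subr_le0 -(pmulr_lle0 _ l2) -E.
apply: sumr_le0 => b _.
apply: le_trans (_ : \sum_a p b a * (p b a * (\sum_d nsq ((U *m (V b) ^t*) d a) / q d) - 1) <= 0).
  rewrite /kl exchange_big; apply: ler_sum => a _ /=.
  have M1 := unitary_rowsum a (unitary_overlap (proj1 eB) (proj1 (eA b))).
  rewrite -[X in _ * (_ - X)]M1 mulr_sumr -sumrB mulr_sumr; apply: ler_sum => d _.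
  have := q0 d; rewrite le_eqVlt => /predU1P[/esym e|qd].
    rewrite (sum_supp eB eA)// e invr0 mulr0 mulr0 mul0r sub0r mulrN.
    by rewrite (sum_supp eB eA)// oppr0.
  rewrite mulrAC; apply: le_trans (ler_wpM2r (nsq_ge0 _) (kl_term_le (p0 b a) qd)) _.
  by rewrite le_eqVlt; apply/orP; left; apply/eqP; ring.
apply: sumr_le0 => a _; rewrite mulr_ge0_le0// subr_le0.
exact: eig_overlap_le1 eB eA b a.
Qed.

End Sum.
End Block.

(** * Steering a purification *)

Section Steer.
Variable R : realType.
Notation C := R[i].

(* Here s = ln (p/q) - L and w = q/p, so the right-hand side is (ln (p/q) + q/p) / L. *)
Lemma logistic_sqr_le (L s w : R) : 0 < L -> 0 < w -> 1 <= L + s + w ->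
  (expR s / (1 + expR s)) ^+ 2 <= (L + s + w) / L.
Proof.
move=> L0 w0 h1.
have y0 := expR_gt0 s; set y := expR s in y0 *.
have y1 : 0 < 1 + y by rewrite addr_gt0.
have f0 : 0 <= y / (1 + y) by rewrite divr_ge0 ?ltW.
have sq (a b : R) : 0 <= a -> a <= b -> a ^+ 2 <= b ^+ 2.
  by move=> a0 ab; rewrite ler_pXn2r// nnegrE (le_trans a0).
rewrite ler_pdivlMr//.
(* Three ranges of s. For s >= 0 the square is at most 1. For -3L/4 <= s < 0 it is at most 1/4, and
   L + s >= L/4. Below that it is at most exp(2 s) <= exp(-3L/2) <= 1/L, and [h1] suffices. *)
have [s0|s0] := leP 0 s.
  apply: le_trans (_ : 1 * L <= _); last by rewrite mul1r; lra.
  rewrite ler_wpM2r ?(ltW L0)//; apply: le_trans (sq _ 1 f0 _) _; last by rewrite expr1n.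
  by rewrite ler_pdivrMr//; lra.
have yle1 : y <= 1 by rewrite -(expR0 R) ler_expR ltW.
have [s1|s1] := leP (- (3 / 4 * L)) s.
  apply: le_trans (_ : 2^-1 ^+ 2 * L <= _); last by lra.
  rewrite ler_wpM2r ?(ltW L0)// sq// ler_pdivrMr//; lra.
apply: le_trans (_ : 1 <= _) => //.
apply: le_trans (_ : y ^+ 2 * L <= _).
  rewrite ler_wpM2r ?(ltW L0)// sq// ler_pdivrMr// -subr_ge0.
  have -> : y * (1 + y) - y = y ^+ 2 by ring.
  by rewrite sqr_ge0.
have hy : y ^+ 2 * expR (3 / 2 * L) <= 1.
  rewrite /y -expRM_natl -expRD -[leRHS](expR0 R) ler_expR; lra.
apply: le_trans hy; rewrite ler_wpM2l ?sqr_ge0//.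
apply: le_trans (expR_ge1Dx _); lra.
Qed.

(** 1 - q / (q + tau p) is the logistic function at ln (p / q) - L. The factor p turns the q / p of
    [logistic_sqr_le] into q, which later sums to the trace: this is the 1 in (D + 1) / L. *)
Lemma steer_term (p q L : R) : 0 < L -> 0 <= p -> 0 < q ->
  p * (q * (q + expR (- L) * p)^-1 - 1) ^+ 2 <= (p * (ln p - ln q) + q) / L.
Proof.
move=> L0; rewrite le_eqVlt => /predU1P[<- q0|p0 q0].
  by rewrite !mul0r add0r divr_ge0 ?ltW.
set s := ln p - ln q - L.
have es : expR s = expR (- L) * p / q.
  by rewrite /s addrC expRD expRB !lnK// mulrA.
have h1 : 1 <= L + s + q / p.
  by have := lnB_le p0 q0; rewrite /s; lra.
have := logistic_sqr_le L0 (divr_gt0 q0 p0) h1; rewrite es.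
set t := expR (- L); have t0 : 0 < t by apply: expR_gt0.
have d0 : q + t * p != 0 by rewrite gt_eqF// addr_gt0// mulr_gt0.
have -> : t * p / q / (1 + t * p / q) = 1 - q * (q + t * p)^-1.
  by field; rewrite ?d0 ?andbT (gt_eqF q0).
rewrite -sqrrN opprB => /(ler_wpM2l (ltW p0)) h; apply: le_trans h _.
rewrite [leLHS]mulrA ler_wpM2r ?invr_ge0 ?(ltW L0)//.
have -> : p * (L + s + q / p) = p * (L + s) + q by field; rewrite gt_eqF.
by rewrite /s (addrC L) subrK.
Qed.

Lemma mul_gram_tr m n (X : 'M[C]_(m, n)) p (K : 'M[C]_m) :
  X *m X ^t* = rdiag p -> fro (K *m X) = \sum_b \sum_a p a * nsq (K b a).
Proof.
move=> XX; apply: (@complexI R); rewrite fro_trace adjM mulmxA -(mulmxA K) XX.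
by rewrite /mxtrace rmorph_sum; apply: eq_bigr => b _; rewrite rdiagM_gram.
Qed.

Lemma fro_trace_adj m n (A : 'M[C]_(m, n)) : (fro A)%:C%C = \tr (A ^t* *m A).
Proof. by rewrite -fro_adj fro_trace trmxCK. Qed.

Lemma mulmx_subZ m n (X Y : 'M[C]_(n, m)) (A B : 'M[C]_(m, n)) c :
  (X - c *: Y) *m (A - c *: B) =
  X *m A - c *: (X *m B) - (c *: (Y *m A) - c *: (c *: (Y *m B))).
Proof. by rewrite mulmxBl !mulmxBr -!scalemxAl -!scalemxAr. Qed.

Lemma fro_sub m n (A B : 'M[C]_(m, n)) (c r : R) : \tr (A ^t* *m B) = r%:C%C ->
  fro (A - c%:C%C *: B) = fro A - 2 * c * r + c ^+ 2 * fro B.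
Proof.
move=> h.
have h' : \tr (B ^t* *m A) = r%:C%C.
  rewrite -[B ^t* *m A]trmxCK adjM trmxCK -[RHS]conjC_real -h.
  by rewrite /mxtrace raddf_sum; apply: eq_bigr => i _; rewrite !mxE.
have e : (A - c%:C%C *: B) ^t* = A ^t* - c%:C%C *: B ^t*.
  by apply/matrixP => i j; rewrite !mxE rmorphB rmorphM /= conjC_real.
have trB (X Y Z T : 'M[C]_n) : \tr (X - Y - (Z - T)) = \tr X - \tr Y - (\tr Z - \tr T).
  by rewrite !raddfB.
apply: (@complexI R); rewrite fro_trace_adj.
rewrite e mulmx_subZ.
rewrite trB.
rewrite !mxtraceZ.
rewrite h h' -(fro_trace_adj A) -(fro_trace_adj B).
by rewrite rmorphD rmorphB !rmorphM /= rmorph_nat; ring.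
Qed.

(** The largest eigenvalue of N N^* is the squared operator norm of N^*. The hypothesis is about
    eigenvectors because these are what the Sylvester equation can be tested on. *)
Lemma fro_adj_mul_le k l (N : 'M[C]_(k, l)) c :
  (forall s (u : 'cV[C]_k), u != 0 -> N *m N ^t* *m u = s%:C%C *: u -> s <= c) ->
  forall r (W : 'M[C]_(k, r)), fro (N ^t* *m W) <= c * fro W.
Proof.
move=> hs r W.
have hN : (N *m N ^t*) ^t* = N *m N ^t* by rewrite adjM trmxCK.
have [Z [s eZ]] := eig_exists hN; have [Zu eN] := eZ.
have sc j : s j <= c.
  apply: (hs _ (col j (Z ^t*))).
    apply/eqP => e0; have /matrixP /(_ j j) := unitarymxP Zu.
    move/colP: e0 => e0.
    rewrite mxE [RHS]mxE eqxx big1 => [|i _]; last by have := e0 i; rewrite !mxE => ->; rewrite mulr0.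
    by move=> /esym/eqP; rewrite oner_eq0.
  rewrite {1}eN colE !mulmxA -(mulmxA _ Z) (unitarymxP Zu) mulmx1.
  have -> : Z ^t* *m rdiag s *m (delta_mx j 0 : 'cV_k) = (s j)%:C%C *: (Z ^t* *m delta_mx j 0).
    rewrite -mulmxA scalemxAr; congr (_ *m _); apply/colP => i.
    rewrite rdiag_mull !mxE; by case: eqP => [->|]; rewrite ?mulr0.
  by [].
have e1 : (fro (N ^t* *m W))%:C%C = \tr (rdiag s *m ((Z *m W) *m (Z *m W) ^t*)).
  rewrite fro_trace_adj (adjM (N ^t*)) trmxCK mulmxA -(mulmxA _ N) {1}eN.
  by rewrite [in RHS]mulmxA [RHS]mxtrace_mulC (adjM Z) !mulmxA.
rewrite -(fro_unitaryl W Zu) -lecR e1 /mxtrace /fro mulr_sumr rmorph_sum.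
apply: ler_sum => j _; rewrite rdiag_mull mul_adj_diagE -rmorphM lecR.
by rewrite ler_wpM2r// sumr_ge0// => i _; apply: nsq_ge0.
Qed.

Section Transition.
Variables (m k l : nat) (Psi : 'M[C]_(m, k)) (Phi : 'M[C]_(m, l)).
Variables (U V : 'M[C]_m) (q p : 'I_m -> R).
Hypotheses (eq : eigdec (Psi *m Psi ^t*) U q) (ep : eigdec (Phi *m Phi ^t*) V p).
Local Notation M := (U *m V ^t*).
Hypothesis supp : forall a b, q b = 0 -> p a * nsq (M b a) = 0.
Variable tau : R.
Hypothesis tau0 : 0 < tau.

Let X := U *m Psi.
Let Y := V *m Phi.
Let g b a := (q b + tau * p a)^-1.
(** The entrywise solution of diag q G + tau G diag p = M; since 0 has inverse 0, an entry where
    both eigenvalues vanish is 0. *)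
Let G : 'M[C]_m := \matrix_(b, a) (M b a * (g b a)%:C%C).
Definition steer_mx : 'M[C]_(k, l) := X ^t* *m G *m Y.
Local Notation N := steer_mx.

Lemma steerX : X *m X ^t* = rdiag q.
Proof. by rewrite -(eigdecV eq) /X adjM !mulmxA. Qed.

Lemma steerY : Y *m Y ^t* = rdiag p.
Proof. by rewrite -(eigdecV ep) /Y adjM !mulmxA. Qed.

Lemma psd_gram i j (A : 'M[C]_(i, j)) : psd (A *m A ^t*).
Proof.
split=> [|v]; first by rewrite adjM trmxCK.
by rewrite mulmxA -mulmxA -adjM mul_adj_diagE ler0c sumr_ge0// => c _; apply: nsq_ge0.
Qed.

Lemma steer_q0 b : 0 <= q b.
Proof. exact: psd_eig_ge0 (psd_gram Psi) eq. Qed.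

Lemma steer_p0 a : 0 <= p a.
Proof. exact: psd_eig_ge0 (psd_gram Phi) ep. Qed.

Lemma steer_Phi : U *m Phi = M *m Y.
Proof. by rewrite /Y mulmxA -(mulmxA U) (unitary_adjl (proj1 ep)) mulmx1. Qed.

Lemma steer_Psi : U *m (Psi *m N) = rdiag q *m G *m Y.
Proof. by rewrite -steerX /N -/X !mulmxA. Qed.

Lemma fro_steer : fro (Psi *m N) <= \sum_a p a.
Proof.
rewrite -(fro_unitaryl _ (proj1 eq)) steer_Psi (mul_gram_tr _ steerY).
rewrite -(sum_overlap_p p (proj1 eq) (proj1 ep)).
apply: ler_sum => b _; apply: ler_sum => a _; rewrite ler_wpM2l ?steer_p0//.
rewrite rdiag_mull mxE !nsqM !nsqR mulrCA -exprMn -[leRHS]mulr1.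
rewrite ler_wpM2l ?nsq_ge0// /g.
have := steer_q0 b; rewrite le_eqVlt => /predU1P[<-|qb]; first by rewrite mul0r expr0n.
have tp : 0 <= tau * p a by rewrite mulr_ge0 ?(ltW tau0)// steer_p0.
have d0 : 0 < q b + tau * p a by rewrite ltr_wpDr.
have f0 : 0 <= q b / (q b + tau * p a) by rewrite divr_ge0 ?ltW.
rewrite exprn_ile1// ler_pdivrMr//.
by rewrite mul1r lerDl.
Qed.

Lemma fro_steer_sub : fro (Psi *m N - Phi) =
  \sum_b \sum_a p a * nsq (M b a) * (q b * g b a - 1) ^+ 2.
Proof.
rewrite -(fro_unitaryl _ (proj1 eq)) mulmxBr steer_Psi steer_Phi -mulmxBl.
rewrite (mul_gram_tr _ steerY); apply: eq_bigr => b _; apply: eq_bigr => a _.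
rewrite -mulrA; congr (_ * _).
rewrite mxE [X in nsq (_ + X)]mxE rdiag_mull [X in nsq (_ * X - _)]mxE.
rewrite mulrCA -rmorphM -{2}[M b a]mulr1 -mulrBr nsqM; congr (_ * _).
by rewrite -(rmorph1 (real_complex R)) -rmorphB nsqR.
Qed.

(** Entries of the equation can fail only where [q b] and [p a] are both 0. Multiplying by [Y] on
    the right removes them, since row a of [Y] has squared norm [p a]. *)
Lemma steer_sylvester :
  rdiag q *m G *m Y + tau%:C%C *: (G *m rdiag p *m Y) = M *m Y.
Proof.
apply/eqP; rewrite -subr_eq0; apply/eqP/fro_eq0.
rewrite scalemxAl -mulmxDl -mulmxBl (mul_gram_tr _ steerY).
rewrite big1// => b _; rewrite big1// => a _.
have -> : (rdiag q *m G + tau%:C%C *: (G *m rdiag p) - M) b a =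
     M b a * ((q b + tau * p a) * g b a - 1)%:C%C.
  rewrite mxE [X in _ + X]mxE mxE rdiag_mull [X in _ + X - _]mxE rdiag_mulr mxE.
  by rewrite rmorphB !rmorphM /= rmorphD rmorphM /= rmorph1; ring.
rewrite nsqM nsqR /g.
have := steer_p0 a; rewrite le_eqVlt => /predU1P[<-|pa]; first by rewrite mul0r.
by rewrite divff ?subrr ?expr0n ?mulr0// gt_eqF// ltr_wpDl ?steer_q0// mulr_gt0.
Qed.

(* For an eigenvector u of N N^* with eigenvalue s and v = N^* u, the Sylvester
   equation says s |a|^2 + tau |b|^2 = <a, b> for a = Psi u, b = Phi v (up to
   the changes of basis U, V); compare with AM-GM. *)
Lemma steer_opnorm s (u : 'cV[C]_k) :
  u != 0 -> N *m N ^t* *m u = s%:C%C *: u -> s <= (4 * tau)^-1.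
Proof.
move=> u0 hu; rewrite leNgt; apply/negP => s1.
pose v := N ^t* *m u; have hv : N *m v = s%:C%C *: u by rewrite mulmxA.
pose a := X *m u; pose b := Y *m v.
have e : a ^t* *m (M *m b) = s%:C%C *: (a ^t* *m a) + tau%:C%C *: (b ^t* *m b).
  have -> : M *m b = (rdiag q *m G *m Y + tau%:C%C *: (G *m rdiag p *m Y)) *m v.
    by rewrite steer_sylvester /b mulmxA.
  rewrite mulmxDl mulmxDr; congr (_ + _).
    by rewrite -steerX scalemxAr scalemxAr -hv /N !mulmxA.
  rewrite -scalemxAl -scalemxAr; congr (_ *: _).
  by rewrite -steerY /b (adjM Y) /v (adjM (N ^t*)) trmxCK /N /a adjM !mulmxA.
have ea : \tr (a ^t* *m (M *m b)) = (s * fro a + tau * fro b)%:C%C.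
  by rewrite e mxtraceD !mxtraceZ -(fro_trace_adj a) -(fro_trace_adj b) rmorphD !rmorphM.
(* The multiple 2 tau makes the terms in |b|^2 cancel, leaving (1 - 4 tau s) |a|^2. *)
have := fro_ge0 (a - (2 * tau)%:C%C *: (M *m b)).
rewrite (fro_sub _ ea) (fro_unitaryl _ (unitary_overlap (proj1 eq) (proj1 ep))).
have -> : fro a - 2 * (2 * tau) * (s * fro a + tau * fro b) + (2 * tau) ^+ 2 * fro b
   = (1 - 4 * tau * s) * fro a by ring.
have h : 1 - 4 * tau * s < 0.
  by rewrite subr_lt0 -ltr_pdivrMl ?mulr1// mulr_gt0.
rewrite nmulr_rge0// => /fro_eq0 a0.
have v0 : v = 0 by rewrite /v /N (adjM _ Y) (adjM _ G) trmxCK -2!mulmxA -/a a0 !mulmx0.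
have := hv; rewrite v0 mulmx0 => /esym/eqP; rewrite scaler_eq0 (negPf u0) orbF.
rewrite -(rmorph0 (real_complex R)) (inj_eq (@complexI R)) => /eqP s0.
by move: s1; rewrite s0 ltNge invr_ge0 mulr_ge0 // ltW.
Qed.

End Transition.

Lemma steering m k l (Psi : 'M[C]_(m, k)) (Phi : 'M[C]_(m, l)) U V q p L :
  eigdec (Psi *m Psi ^t*) U q -> eigdec (Phi *m Phi ^t*) V p ->
  (forall a b, q b = 0 -> p a * nsq ((U *m V ^t*) b a) = 0) ->
  \sum_a p a = 1 -> \sum_b q b = 1 -> 0 < L ->
  exists N : 'M[C]_(k, l), [/\ contr (expR L / 4) (N ^T),
    fro (Psi *m N) <= 1 & fro (Psi *m N - Phi) <= (kl U V p q + 1) / L].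
Proof.
move=> eq ep supp p1 q1 L0.
have t0 : 0 < expR (- L) by apply: expR_gt0.
exists (steer_mx Psi Phi U V q p (expR (- L))); set N := steer_mx _ _ _ _ _ _ _.
split.
(* Conjugating entries turns the bound for N^* into one for N^T, the form in which N acts on Bob's
   states. *)
- move=> r W; rewrite -fro_conj map_mxM -(fro_conj W).
  apply: le_trans (_ : (4 * expR (- L))^-1 * fro (map_mx Num.conj W) <= _).
    apply: fro_adj_mul_le => s u; exact: (steer_opnorm eq ep).
  by rewrite invfM -expRN opprK [4^-1 * _]mulrC.
- by rewrite -p1; apply: (fro_steer eq ep).
rewrite (fro_steer_sub eq ep) /kl -[X in _ + X]q1 -(sum_overlap_q q (proj1 eq) (proj1 ep)).
rewrite -big_split mulr_suml; apply: ler_sum => b _.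
rewrite -big_split mulr_suml; apply: ler_sum => a _ /=.
have p0 := steer_p0 ep a.
have := steer_q0 eq b; rewrite le_eqVlt => /predU1P[/esym e|qb].
  by rewrite supp// !mul0r e mul0r addr0 mul0r.
rewrite mulrAC; apply: le_trans (ler_wpM2r (nsq_ge0 _) (steer_term L0 p0 qb)) _.
by rewrite le_eqVlt; apply/orP; left; apply/eqP; ring.
Qed.

End Steer.

(** * Steering for all of Bob's inputs, and the resulting information bound *)

Section Core.
Variable R : realType.
Notation C := R[i].

(** Half of the bias 2 eps is given up. The weight t = eps / 4 costs eps / 2 through the norms, and
    [L] is chosen so that the average distance, at most (K + 1) / L, costs the other eps / 2. *)
Lemma steering_bias (I : finType) (i0 : I) m k l (Psi : 'M[C]_(m, k))
    (Phi : I -> 'M[C]_(m, l)) (th : I -> 'I_m -> 'I_l -> R) (eps K : R) :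
  0 < eps -> 0 <= K ->
  Psi *m Psi ^t* = mxavg (fun i => Phi i *m (Phi i) ^t*) ->
  (forall i, fro (Phi i) = 1) -> (forall i a b, `|th i a b| <= 1) ->
  (ent (Psi *m Psi ^t*) - avg (fun i => ent (Phi i *m (Phi i) ^t*))) * ln 2 <= K ->
  2 * eps <= avg (fun i => \sum_a \sum_b th i a b * nsq (Phi i a b)) ->
  exists N : I -> 'M[C]_(k, l),
   (forall i, contr (expR (4 * (K + 1) / eps ^+ 2) / 4) ((N i) ^T)) /\
   eps <= avg (fun i => \sum_a \sum_b th i a b * nsq ((Psi *m N i) a b)).
Proof.
move=> e0 K0 ePhi f1 th1 hK hb; set L := 4 * _ / _.
have L0 : 0 < L by rewrite divr_gt0 ?exprn_gt0// mulr_gt0//; lra.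
have pPsi := psd_gram Psi.
have pPhi i := psd_gram (Phi i).
have [U [q eq]] := eig_exists (proj1 pPsi).
have /fin_all_exists [V /fin_all_exists [p ep]] i : exists V, exists p, eigdec (Phi i *m (Phi i) ^t*) V p.
  exact: eig_exists (proj1 (pPhi i)).
have p1 i : \sum_a p i a = 1.
  by apply: (@complexI R); rewrite -(eigdec_tr (ep i)) -fro_trace f1.
have c0 : 0 < #|I|%:R^-1 :> R by rewrite invr_gt0 ltr0n; apply/card_gt0P; exists i0.
have q1 : \sum_b q b = 1.
  apply: (@complexI R); rewrite -(eigdec_tr eq) ePhi.
  have d i : density (Phi i *m (Phi i) ^t*) := conj (pPhi i) (etrans (esym (fro_trace _)) (congr1 _ (f1 i))).
  by have [_ ->] := density_mxavg i0 d.
have supp i a b : q b = 0 -> p i a * nsq ((U *m (V i) ^t*) b a) = 0.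
  by move=> qb; apply: (mixture_support (c := fun _ => #|I|%:R^-1) eq ep ePhi pPhi) => // _; exact: ltW.
have /fin_all_exists [N hN] i := steering eq (ep i) (supp i) (p1 i) q1 L0.
exists N; split=> [i|]; first by have [] := hN i.
have hkl : avg (fun i => kl U (V i) (p i) q) <= K.
  apply: le_trans hK; rewrite /avg !mulr_sumr.
  by rewrite (mixture_ent (c := fun _ => #|I|%:R^-1) eq ep ePhi pPhi pPsi).
have t0 : 0 < eps / 4 by rewrite divr_gt0.
have step i : \sum_a \sum_b th i a b * nsq (Phi i a b) -
     ((2 / eps / L) * kl U (V i) (p i) q + (2 / eps / L + eps / 2)) <=
     \sum_a \sum_b th i a b * nsq ((Psi *m N i) a b).
  have [_ h1 h2] := hN i.
  have := wsum_diff (Psi *m N i) (Phi i) (th1 i) t0; rewrite f1.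
  move: h1 h2; move: (fro _) (fro _) (\sum_a _) (\sum_a _) (kl _ _ _ _) => y x A B D h1 h2 h.
  have {h} h : A - B <= y / (2 * (eps / 4)) + eps / 4 * (x + 1).
    by apply: le_trans h; rewrite distrC; exact: ler_norm.
  have hy : y / (2 * (eps / 4)) <= (2 / eps / L) * D + 2 / eps / L.
    have -> : (2 / eps / L) * D + 2 / eps / L = (D + 1) / L / (2 * (eps / 4)).
      by field; rewrite !gt_eqF.
    by rewrite ler_wpM2r// invr_ge0 mulr_ge0// ltW.
  have hx : eps / 4 * (x + 1) <= eps / 2.
    have -> : eps / 2 = eps / 4 * (1 + 1) by field.
    by rewrite ler_wpM2l ?(ltW t0)// lerD2r.
  lra.
apply: le_trans (ler_avg step); rewrite avgB avgD avgZ (avg_const i0).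
move: hkl hb; move: (avg _) (avg _) => B D hD hB.
have hh : 2 / eps / L * D + 2 / eps / L <= eps / 2.
  have -> : 2 / eps / L * D + 2 / eps / L = (D + 1) * (2 / eps / L) by ring.
  have -> : eps / 2 = (K + 1) * (2 / eps / L).
    by rewrite /L; field; rewrite !gt_eqF//; lra.
  have hw : 0 <= 2 / eps / L by apply: divr_ge0 (ltW L0); apply: divr_ge0 (ltW e0).
  by apply: ler_wpM2r => //; rewrite lerD2r.
lra.
Qed.

Lemma contr_blk m n c (W : 'M[C]_(m, n)) : contr c W -> contr c (blk W W).
Proof.
move=> hW r F; rewrite -[F]vsubmxK /blk mul_block_col !mul0mx addr0 add0r.
have fc i j (A : 'M[C]_(i, r)) (B : 'M[C]_(j, r)) : fro (col_mx A B) = fro A + fro B.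
  rewrite /fro big_split_ord; congr (_ + _); apply: eq_bigr => a _; apply: eq_bigr => b _.
    by rewrite col_mxEu.
  by rewrite col_mxEd.
by rewrite !fc mulrDr lerD.
Qed.

Lemma readout_blk m n (W : 'M[C]_(m, n)) (A0 A1 : 'M[C]_n) :
  readout (blkw (fun _ => 1) (fun _ => -1)) (blk W W) (blk A0 A1) =
  readout (fun _ => 1) W A0 - readout (fun _ => 1) W A1.
Proof.
rewrite /readout blk_adj !blkM big_split_ord -sumrN; congr (_ + _);
  apply: eq_bigr => i _; rewrite /blkw.
  by rewrite (unsplitK (inl i)) /blk block_mxEul.
by rewrite (unsplitK (inr i)) /blk block_mxEdr mulN1r mul1r.
Qed.

Lemma mxavg_blk (T : finType) n (f g : T -> 'M[C]_n) :
  mxavg (fun t => blk (f t) (g t)) = blk (mxavg f) (mxavg g).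
Proof.
have blkE A B : blk A B = blk A 0 + blk 0 B :> 'M[C]_(n + n).
  by rewrite /blk add_block_mx !addr0 !add0r.
have e h : blk (mxavg h) 0 = mxavg (fun t : T => blk (h t) 0) :> 'M[C]_(n + n).
  apply: (big_ind2 (fun A B => blk A 0 = B)) => [|A B A' B' <- <-|t _].
  - by rewrite /blk block_mx0.
  - by rewrite /blk add_block_mx !addr0.
  - by rewrite /blk scale_block_mx !scaler0.
have e' h : blk 0 (mxavg h) = mxavg (fun t : T => blk 0 (h t)) :> 'M[C]_(n + n).
  apply: (big_ind2 (fun A B => blk 0 A = B)) => [|A B A' B' <- <-|t _].
  - by rewrite /blk block_mx0.
  - by rewrite /blk add_block_mx !addr0.
  - by rewrite /blk scale_block_mx !scaler0.
by rewrite blkE e e' -mxavgD; apply: eq_mxavg => t; rewrite blkE.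
Qed.

Section Bits.
Variables (n k l m : nat).
Notation X := {ffun 'I_n -> bool}.

(* F x is a purification, with columns indexed by Alice's registers, of Bob's
   state on input x; ansA tells whether the answer is on Alice's side. *)
Lemma info_lower (F : X -> 'M[C]_(k, m)) (N : 'I_n -> 'M[C]_(k, l)) (zA : 'I_m -> bool)
  (zB : 'I_l -> bool) (ansA : bool) (c eps : R) :
  (forall x, fro (F x) = 1) -> 0 < c -> 0 < eps -> (forall i, contr c ((N i) ^T)) ->
  eps <= avg (fun i : 'I_n => avg (fun x : X => sgb R (x i) *
     \sum_j \sum_a sgb R (if ansA then zA a else zB j) * nsq (((N i) ^T *m F x) j a))) ->
  n%:R * eps ^+ 2 / (4 * c ^+ 2 * ln 2) - 1 <=
  ent (mxavg (fun x => F x *m (F x) ^t*)) - avg (fun x => ent (F x *m (F x) ^t*)).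
Proof.
move=> f1 c0 e0 cN hb.
have l2 := ln2_gt0 R.
have d x : density (F x *m (F x) ^t*).
  by split; [exact: psd_gram|rewrite -fro_trace f1].
have sum_ge (D : 'I_n -> R) : eps <= avg D ->
   n%:R * eps ^+ 2 / (4 * c ^+ 2 * ln 2) <= \sum_j D j ^+ 2 / (4 * c ^+ 2 * ln 2).
  move=> hD; rewrite -mulr_suml; apply: ler_wpM2r.
    by rewrite invr_ge0; apply: mulr_ge0 (ltW l2); apply: mulr_ge0 (sqr_ge0 c).
  have [n0|n0] := posnP n.
    move: hD; rewrite {1}/avg big1 ?mulr0 ?leNgt ?e0// => i _.
    by have := ltn_ord i; rewrite [X in (_ < X)%N]n0.
  have nR : 0 < n%:R :> R by rewrite ltr0n.
  have h : avg D ^+ 2 <= avg (fun i => D i ^+ 2) := avg_sqr_le (Ordinal n0) D.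
  have h' : eps ^+ 2 <= n%:R^-1 * \sum_j D j ^+ 2.
    move: h; rewrite {2}/avg card_ord; apply: le_trans.
    by rewrite ler_pXn2r// nnegrE ltW// (lt_le_trans e0).
  by rewrite -ler_pdivlMl.
have absS b : `|sgb R b| <= 1 by rewrite /sgb normr_sign.
case: ansA hb => hb.
  (* [G b x] keeps the columns where Alice's answer is b. Once Bob is given that bit, the answer is
     an observable on his block-diagonal state, with sign +1 on one block and -1 on the other. *)
  pose G b x : 'M[C]_(k, m) := \matrix_(i, a) (if zA a == b then F x i a else 0).
  have FG x : F x *m (F x) ^t* = G false x *m (G false x) ^t* + G true x *m (G true x) ^t*.
    apply/matrixP => i j; rewrite !mxE -big_split; apply: eq_bigr => a _; rewrite !mxE.
    by case: (zA a); rewrite /= ?raddf0 ?mulr0 ?mul0r ?add0r ?addr0.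
  pose s x := blk (G false x *m (G false x) ^t*) (G true x *m (G true x) ^t*).
  have pG b x := psd_gram (G b x).
  have ds x : density (s x).
    split; first by apply: psd_blk.
    by rewrite tr_blk -mxtraceD -FG; have [] := d x.
  pose z : 'I_(l + l) -> R := blkw (fun _ => 1) (fun _ => -1).
  have z1 j : `|z j| <= 1 by rewrite /z /blkw; case: split => _; rewrite ?normrN normr1.
  have := chain ds (fun _ : 'I_n => z1) c0 (fun j => contr_blk (cN j)).
  move=> h; rewrite lerBlDr.
  (* The bit raises the entropy of the average by at most 1 and lowers no individual entropy, so it
     adds at most 1 to the information: this is the -1 in the bound. *)
  have h1 : ent (mxavg s) <= ent (mxavg (fun x => F x *m (F x) ^t*)) + 1.
    rewrite /s mxavg_blk (eq_mxavg FG) mxavgD; apply: ent_blk_le.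
    - by apply: psd_comb => // t; rewrite invr_ge0.
    - by apply: psd_comb => // t; rewrite invr_ge0.
    - rewrite -mxavgD -(eq_mxavg FG).
      by have [_ ->] := density_mxavg [ffun=> false] d.
  have h2 : avg (fun x => ent (F x *m (F x) ^t*)) <= avg (fun x => ent (s x)).
    by apply: ler_avg => x; rewrite FG; apply: ent_blk_ge.
  apply: le_trans (_ : ent (mxavg s) - avg (fun x => ent (s x)) <= _); last by lra.
  apply: le_trans h; apply: sum_ge; apply: le_trans hb _; rewrite le_eqVlt; apply/orP; left.
  apply/eqP; apply: eq_avg => i; apply: eq_avg => x; congr (_ * _).
  rewrite readout_blk !readout_gram -sumrB; apply: eq_bigr => j _.
  rewrite -sumrB; apply: eq_bigr => a _; rewrite !mul1r.
  have NG b : ((N i) ^T *m G b x) j a = if zA a == b then ((N i) ^T *m F x) j a else 0.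
    rewrite !mxE; case: ifP => zb; last by rewrite big1// => y _; rewrite !mxE zb mulr0.
    by apply: eq_bigr => y _; rewrite !mxE zb.
  have n0 : nsq (0 : C) = 0 by rewrite /nsq /= expr0n addr0.
  rewrite !NG; case: (zA a) => /=; rewrite n0 /sgb ?expr1 ?expr0 ?mulN1r ?mul1r ?sub0r ?subr0 //.
have := chain d (fun (_ : 'I_n) i => absS (zB i)) c0 cN.
apply: le_trans; apply: le_trans (_ : n%:R * eps ^+ 2 / (4 * c ^+ 2 * ln 2) <= _).
  by rewrite lerBlDr lerDl.
apply: sum_ge; apply: le_trans hb _; rewrite le_eqVlt; apply/orP; left.
apply/eqP; apply: eq_avg => i; apply: eq_avg => x; congr (_ * _).
by rewrite readout_gram.
Qed.

End Bits.
End Core.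

(** * From operators on labelled bases to matrices *)

Section Kernel.
Variable R : realType.
Notation C := R[i].

Definition kmx (T U : finType) (K : T -> U -> C) : 'M[C]_(#|T|, #|U|) :=
  \matrix_(i, j) K (enum_val i) (enum_val j).

Lemma sum_enum_val (V : nmodType) (T : finType) (f : T -> V) :
  \sum_(i < #|T|) f (enum_val i) = \sum_t f t.
Proof. by rewrite -(big_enum_val f); apply: eq_bigl. Qed.

Lemma kmxM (T U V : finType) (K : T -> U -> C) (L : U -> V -> C) :
  kmx K *m kmx L = kmx (fun t v => \sum_u K t u * L u v).
Proof.
apply/matrixP => i j; rewrite !mxE -[RHS]sum_enum_val.
by apply: eq_bigr => u _; rewrite !mxE.
Qed.

Lemma kmx_adj (T U : finType) (K : T -> U -> C) :
  (kmx K) ^t* = kmx (fun u t => (K t u)^*).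
Proof. by apply/matrixP => i j; rewrite !mxE. Qed.

Lemma fro_kmx (T U : finType) (K : T -> U -> C) : fro (kmx K) = \sum_t \sum_u nsq (K t u).
Proof.
rewrite /fro -[RHS]sum_enum_val; apply: eq_bigr => i _.
by rewrite -[RHS]sum_enum_val; apply: eq_bigr => j _; rewrite mxE.
Qed.

Lemma vN_entE (T : finType) (A : op R T) : vN_entropy A = ent (kmx A).
Proof. by []. Qed.

(** Eigenvectors may carry any labels [J], for instance a value of a classical register paired with
    an eigenvector of its conditional state. *)
Lemma vN_basis (T J : finType) (A : op R T) (e : J -> T -> C) (w : J -> R) :
  #|J| = #|T| ->
  (forall s t, \sum_i e s i * (e t i)^* = (s == t)%:R) ->
  (forall i j, A i j = \sum_s (e s i)^* * (w s)%:C%C * e s j) ->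
  vN_entropy A = - \sum_s xlog2x (w s).
Proof.
move=> cJ on eA; pose f (i : 'I_#|T|) : J := enum_val (cast_ord (esym cJ) i).
have sumf (V : nmodType) (g : J -> V) : \sum_(i < #|T|) g (f i) = \sum_s g s.
  rewrite -[RHS]sum_enum_val /f.
  by rewrite [RHS](reindex (cast_ord (esym cJ)))//; exists (cast_ord cJ) => i _; rewrite ?cast_ordK ?cast_ordKV.
have fI : injective f by move=> i j /enum_val_inj /cast_ord_inj.
pose U : 'M[C]_#|T| := \matrix_(s, i) e (f s) (enum_val i).
have eU : eigdec (kmx A) U (fun i => w (f i)).
  split.
    apply/unitarymxP/matrixP => s t; rewrite !mxE -(inj_eq fI) -on -[RHS]sum_enum_val.
    by apply: eq_bigr => i _; rewrite !mxE.
  apply/matrixP => i j; rewrite -mulmxA !mxE eA -sumf; apply: eq_bigr => s _.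
  by rewrite rdiag_mull !mxE mulrA.
by rewrite vN_entE (ent_eigdec eU) (sumf _ (fun s => xlog2x (w s))).
Qed.

Lemma xlog2x_div (p r : R) : 0 <= p -> 0 < r ->
  xlog2x (p / r) = r^-1 * xlog2x p - p * r^-1 * (ln r / ln 2).
Proof.
move=> p0 r0; rewrite xlog2xE ?divr_ge0 ?(ltW r0)// xlog2xE//.
move: p0; rewrite le_eqVlt => /predU1P[<-|p0]; first by rewrite !mul0r mulr0 subr0.
by rewrite ln_div ?posrE//; ring.
Qed.

(* T labels a uniformly distributed classical register, and op1 the joint state. *)
Lemma cq_entropy (T H W : finType) (t0 : T) (S : T -> 'M[C]_#|H|) (g : W -> T) (h : W -> H)
  (mk : T -> H -> W) (op0 : op R T) (op1 : op R W) :
  (forall t, density (S t)) ->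
  (forall t s, g (mk t s) = t) -> (forall t s, h (mk t s) = s) ->
  (forall w, mk (g w) (h w) = w) ->
  (forall t t', op0 t t' = if t == t' then (#|T|%:R^-1)%:C%C else 0) ->
  (forall w w', op1 w w' = if g w == g w' then
      (#|T|%:R^-1)%:C%C * S (g w) (enum_rank (h w)) (enum_rank (h w')) else 0) ->
  vN_entropy op0 - vN_entropy op1 = - avg (fun t => ent (S t)).
Proof.
move=> dS gK hK mkK e0 e1.
have l2 := ln2_gt0 R.
have N0 : 0 < #|T|%:R :> R by rewrite ltr0n; apply/card_gt0P; exists t0.
have pS t : psd (S t) by have [] := dS t.
have /fin_all_exists [U /fin_all_exists [p ep]] t : exists U, exists p, eigdec (S t) U p.
  exact: eig_exists (proj1 (pS t)).
have p0 t a : 0 <= p t a := psd_eig_ge0 a (pS t) (ep t).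
have p1 t : \sum_a p t a = 1.
  by apply: (@complexI R); rewrite -(eigdec_tr (ep t)); have [_ ->] := dS t.
have sumW (V : nmodType) (f : W -> V) : \sum_w f w = \sum_t \sum_s f (mk t s).
  rewrite pair_big /= (reindex (fun u : T * H => mk u.1 u.2)) //.
  by exists (fun w => (g w, h w)) => [[t s]|w] _ /=; rewrite ?gK ?hK ?mkK.
have -> : vN_entropy op0 = ln #|T|%:R / ln 2.
  rewrite (vN_basis (J := T) (e := fun s t => (s == t)%:R) (w := fun _ => #|T|%:R^-1))//.
  - have -> : xlog2x (#|T|%:R^-1 : R) = - (#|T|%:R^-1 * (ln #|T|%:R / ln 2)).
      rewrite -[X in xlog2x X]mul1r xlog2x_div// [xlog2x 1]xlog2xE// ln1.
      by rewrite mulr0 mul0r mulr0 sub0r mul1r.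
    by rewrite sumr_const mulNrn opprK -[LHS]mulr_natl mulVKf// gt_eqF.
  - move=> s t; rewrite (bigD1 s)//= big1 => [|i /negPf si]; last by rewrite eq_sym si mul0r.
    by rewrite eqxx mul1r addr0 conjC_nat eq_sym.
  - move=> i j; rewrite e0 (bigD1 i)//= big1 => [|s /negPf si]; last by rewrite si conjC_nat !mul0r.
    by rewrite eqxx addr0 conjC_nat mul1r; case: eqP; rewrite ?mulr1 ?mulr0.
rewrite (vN_basis (J := (T * H)%type)
   (e := fun u w => if u.1 == g w then U u.1 (enum_rank u.2) (enum_rank (h w)) else 0)
   (w := fun u => p u.1 (enum_rank u.2) / #|T|%:R)).
- have sumH (f : 'I_#|H| -> R) : \sum_s f (enum_rank s) = \sum_i f i.
    by rewrite -sum_enum_val; apply: eq_bigr => i _; rewrite enum_valK.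
  rewrite opprK -(pair_big xpredT xpredT (fun t s => xlog2x (p t (enum_rank s) / #|T|%:R))) /=.
  have e t : \sum_s xlog2x (p t (enum_rank s) / #|T|%:R) =
      #|T|%:R^-1 * - ent (S t) - #|T|%:R^-1 * (ln #|T|%:R / ln 2).
    rewrite (sumH (fun i => xlog2x (p t i / #|T|%:R))).
    under eq_bigr do rewrite xlog2x_div//.
    rewrite sumrB -mulr_sumr (ent_eigdec (ep t)) opprK; congr (_ - _).
    by rewrite -mulr_suml -mulr_suml p1 mul1r.
  under eq_bigr do rewrite e.
  rewrite sumrB sumr_const -[X in _ - X]mulr_natl mulVKf ?gt_eqF//.
  by rewrite addrC subrK /avg -mulr_sumr sumrN mulrN.
- apply: (@bij_eq_card _ _ (fun u : T * H => mk u.1 u.2)).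
  by exists (fun w => (g w, h w)) => [[t s]|w] /=; rewrite ?gK ?hK ?mkK.
- move=> [t s] [t' s'] /=; rewrite sumW.
  rewrite (bigD1 t)//= [X in _ + X]big1 ?addr0 => [|u /negPf ut]; last first.
    by rewrite big1// => y _; rewrite gK eq_sym ut mul0r.
  have [<-|tt] := eqVneq t t'; last first.
    rewrite big1 => [|y _]; first by rewrite xpair_eqE (negPf tt).
    by rewrite !gK eqxx eq_sym (negPf tt) raddf0 mulr0.
  have /unitarymxP /matrixP /(_ (enum_rank s) (enum_rank s')) := proj1 (ep t).
  rewrite xpair_eqE eqxx /= !mxE (inj_eq enum_rank_inj) => <-.
  rewrite -[LHS]sum_enum_val; apply: eq_bigr => y _.
  by rewrite !gK !hK eqxx !mxE enum_valK.
- move=> w w'; rewrite e1.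
  rewrite -(pair_big xpredT xpredT (fun t s => (if t == g w then U t (enum_rank s) (enum_rank (h w)) else 0)^*
     * (p t (enum_rank s) / #|T|%:R)%:C%C * (if t == g w' then U t (enum_rank s) (enum_rank (h w')) else 0))) /=.
  rewrite (bigD1 (g w))//= [X in _ + X]big1 ?addr0 => [|u /negPf ut]; last first.
    by rewrite big1// => y _; rewrite ut raddf0 !mul0r.
  case: eqP => [_|_]; last by rewrite big1// => y _; rewrite mulr0.
  have [_ {1}->] := ep (g w); rewrite -mulmxA mxE mulr_sumr -[RHS]sum_enum_val.
  apply: eq_bigr => y _; rewrite rdiag_mull !mxE eqxx enum_valK rmorphM /=.
  by ring.
Qed.

Lemma ptrace_sum (T U V : finType) (keep : T -> U) (drop : T -> V) (mk : U -> V -> T)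
   (rho : op R T) u u' :
  (forall u v, keep (mk u v) = u) -> (forall u v, drop (mk u v) = v) ->
  (forall t, mk (keep t) (drop t) = t) ->
  ptrace keep drop rho u u' = \sum_v rho (mk u v) (mk u' v).
Proof.
move=> kK dK mkK.
have sumT (f : T -> C) : \sum_t f t = \sum_v \sum_u f (mk u v).
  rewrite pair_big /= (reindex (fun z : V * U => mk z.2 z.1)) //.
  by exists (fun w => (drop w, keep w)) => [[t s]|w] _ /=; rewrite ?kK ?dK ?mkK.
rewrite /ptrace sumT; apply: eq_bigr => v _.
rewrite (bigD1 u)//= [X in _ + X]big1 ?addr0 => [|y /negPf yu]; last first.
  by rewrite big1// => t _; rewrite kK yu.
rewrite sumT (bigD1 v)//= [X in _ + X]big1 ?addr0 => [|y /negPf yu]; last first.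
  by rewrite big1// => t _; rewrite !dK [v == y]eq_sym yu !andbF.
rewrite (bigD1 u')//= [X in _ + X]big1 ?addr0 => [|y /negPf yu]; last first.
  by rewrite !kK yu andbF.
by rewrite !kK !dK !eqxx.
Qed.

End Kernel.

(** * The final state of a protocol *)

Section Registers.
Variables (R : realType) (nq : nat).
Notation C := R[i].

Definition qglue (S : {set 'I_nq}) (u : QS S) (w : QS (~: S)) : Q nq :=
  [ffun i => if (insub i : option (qsub S)) is Some s then u s else
     if (insub i : option (qsub (~: S))) is Some s then w s else false].

Lemma qres_gluel S (u : QS S) (w : QS (~: S)) : qres S (qglue u w) = u.
Proof. by apply/ffunP => s; rewrite !ffunE valK. Qed.

Lemma qres_gluer S (u : QS S) (w : QS (~: S)) : qres (~: S) (qglue u w) = w.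
Proof.
apply/ffunP => s; rewrite !ffunE valK insubN//.
by have := valP s; rewrite inE.
Qed.

Lemma qglueK S (q : Q nq) : qglue (qres S q) (qres (~: S) q) = q.
Proof.
apply/ffunP => i; rewrite ffunE; have [iS|iS] := boolP (i \in S).
  by rewrite insubT ffunE.
have iS' : i \in ~: S by rewrite inE.
by rewrite insubN// insubT ffunE.
Qed.

Lemma sum_qglue (V : nmodType) S (f : Q nq -> V) :
  \sum_q f q = \sum_(u : QS S) \sum_(w : QS (~: S)) f (qglue u w).
Proof.
rewrite pair_big /= (reindex (fun z : QS S * QS (~: S) => qglue z.1 z.2)) //.
by exists (fun q => (qres S q, qres (~: S) q)) => [[u w]|q] _ /=;
  rewrite ?qres_gluel ?qres_gluer ?qglueK.
Qed.

Lemma lift_op_glue S (V : op R (QS S)) u w u' w' :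
  lift_op S V (qglue u w) (qglue u' w') = if w == w' then V u u' else 0.
Proof.
rewrite /lift_op !qres_gluel; congr (if _ then _ else _).
apply/forallP/eqP => [h|-> i]; last first.
  by apply/implyP => iS; rewrite !ffunE insubN.
apply/ffunP => s; have sS : val s \notin S by have := valP s; rewrite inE.
have /implyP /(_ sS) := h (val s).
by rewrite !ffunE insubN// valK => /eqP.
Qed.

Lemma unitary_kmx (T : finType) (V : op R T) : unitary V -> kmx V \is unitarymx.
Proof.
move=> [e _]; apply/unitarymxP; rewrite kmx_adj kmxM; apply/matrixP => i j.
rewrite !mxE; have := congr1 (fun f => f (enum_val i) (enum_val j)) e.
by rewrite /opmul /adj /idop (inj_eq enum_val_inj).
Qed.

Lemma unitary_isometry (T : finType) (V : op R T) (f : T -> C) : unitary V ->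
  \sum_t nsq (\sum_t' V t t' * f t') = \sum_t nsq (f t).
Proof.
move=> /unitary_kmx uV; pose F := kmx (fun t (_ : unit) => f t).
have := fro_unitaryl F uV; rewrite /F kmxM !fro_kmx.
have su (g : unit -> R) : \sum_u g u = g tt.
  by rewrite (bigD1 tt)//= big1 ?addr0// => -[].
by under eq_bigr do rewrite su; under [in RHS]eq_bigr do rewrite su.
Qed.

Lemma lift_isometry S (V : op R (QS S)) (f : Q nq -> C) : unitary V ->
  \sum_q nsq (\sum_q' lift_op S V q q' * f q') = \sum_q nsq (f q).
Proof.
move=> uV; rewrite !(sum_qglue S) exchange_big [RHS]exchange_big /=.
apply: eq_bigr => w _; rewrite -(unitary_isometry (fun u => f (qglue u w)) uV).
apply: eq_bigr => u _; congr nsq; rewrite (sum_qglue S); apply: eq_bigr => u' _.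
rewrite (bigD1 w)//= big1 => [|w' /negPf ww]; last by rewrite lift_op_glue eq_sym ww mul0r.
by rewrite lift_op_glue eqxx addr0.
Qed.

End Registers.

Section Run.
Variables (R : realType) (X Y : finType) (P : protocol R X Y).
Notation C := R[i].
Notation qs := (Q (nq P)).

Definition round_mx (t : nat) (x : X) (y : Y) : op R qs :=
  if alice_turn P t then lift_op (own P t) (UA P t x)
  else lift_op (~: own P t) (UB P t y).

(* Inputs are only used as controls, so the run is determined by the pure state
   reached on each pair of basis inputs. *)
Fixpoint amp (t : nat) (x : X) (y : Y) : qs -> C :=
  if t is s.+1 then fun q => \sum_q' round_mx s x y q q' * amp s x y q' else init P.

Definition pure_run (rX : op R X) (rY : op R Y) t : op R (X * qs * Y)%type :=
  fun a b => rX a.1.1 b.1.1 * (amp t a.1.1 a.2 a.1.2 * (amp t b.1.1 b.2 b.1.2)^*) * rY a.2 b.2.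

Lemma sum_triple (V : nmodType) (f : X * qs * Y -> V) :
  \sum_j f j = \sum_x \sum_q \sum_y f (x, q, y).
Proof. by rewrite pair_big pair_big /=; apply: eq_bigr => -[[x q] y]. Qed.

Lemma sum_round (t : nat) a (f : X * qs * Y -> C) :
  \sum_j round_op P t a j * f j =
  \sum_q' round_mx t a.1.1 a.2 a.1.2 q' * f (a.1.1, q', a.2).
Proof.
case: a => [[x q] y] /=.
rewrite sum_triple /=.
rewrite (bigD1 x)//= [X in _ + X]big1 ?addr0 => [|x' /negPf xx]; last first.
  by rewrite big1// => q' _; rewrite big1// => y' _; rewrite eq_sym xx !mul0r.
apply: eq_bigr => q' _; rewrite (bigD1 y)//= [X in _ + X]big1 ?addr0 => [|y' /negPf yy]; last first.
  by rewrite [y == y']eq_sym yy mulr0 !mul0r.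
by rewrite !eqxx !mul1r /round_mx; case: ifP.
Qed.

Lemma evolve_pure rX rY t : evolve (round_op P t) (pure_run rX rY t) = pure_run rX rY t.+1.
Proof.
apply/boolp.funext => a; apply/boolp.funext => b; rewrite /evolve /opmul /adj.
under eq_bigr do rewrite sum_round.
transitivity (\sum_j (round_op P t b j * (\sum_q' round_mx t a.1.1 a.2 a.1.2 q' *
    pure_run rX rY t (a.1.1, q', a.2) j)^*)^*).
  by apply: eq_bigr => j _; rewrite rmorphM /= conjCK mulrC.
rewrite -rmorph_sum sum_round rmorph_sum /= /pure_run /=.
under eq_bigr do rewrite rmorphM /= conjCK.
transitivity (\sum_q' (round_mx t b.1.1 b.2 b.1.2 q')^* * (amp t b.1.1 b.2 q')^* *
  (rX a.1.1 b.1.1 * rY a.2 b.2 * amp t.+1 a.1.1 a.2 a.1.2)).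
  apply: eq_bigr => q' _; rewrite -mulrA; congr (_ * _).
  rewrite /= !mulr_sumr; apply: eq_bigr => q'' _; ring.
rewrite -mulr_suml /=.
have -> : \sum_q' (round_mx t b.1.1 b.2 b.1.2 q')^* * (amp t b.1.1 b.2 q')^* =
    (\sum_q' round_mx t b.1.1 b.2 b.1.2 q' * amp t b.1.1 b.2 q')^*.
  by rewrite rmorph_sum; apply: eq_bigr => q' _; rewrite rmorphM.
by ring.
Qed.

Lemma run_pure rX rY : run P (init_state P rX rY) = pure_run rX rY (nr P).+1.
Proof.
have -> : init_state P rX rY = pure_run rX rY 0.
  apply/boolp.funext => -[[x q] y]; apply/boolp.funext => -[[x' q'] y'].
  by rewrite /init_state /pure_run /ketbra.
have H m : forall s, foldl (fun rho t => evolve (round_op P t) rho) (pure_run rX rY s) (iota s m)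
    = pure_run rX rY (s + m).
  by elim: m => [|m IH] s; rewrite ?addn0//= evolve_pure IH addSnnS.
exact: H.
Qed.

Hypothesis vP : valid_protocol P.

Lemma amp_norm t x y : (t <= (nr P).+1)%N -> \sum_q nsq (amp t x y q) = 1.
Proof.
have [i1 uA uB _ _] := vP.
elim: t => [_|t IH tn] /=.
  apply: (@complexI R); rewrite rmorph_sum; apply: etrans i1; apply: eq_bigr => q _ /=.
  by rewrite nsqE normCK.
rewrite /round_mx -[RHS](IH (ltnW tn)); case: ifP => h.
  exact: lift_isometry (uA t x tn h).
exact: lift_isometry (uB t y tn (negbT h)).
Qed.

End Run.

Arguments amp {R X Y} P t x y _.
Arguments pure_run {R X Y} P rX rY t _ _.

(** * Privacy losses as Holevo quantities of families of pure states *)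

Section Loss.
Variables (R : realType) (X Y : finType) (P : protocol R X Y).
Notation C := R[i].
Hypothesis vP : valid_protocol P.
Variables (x0 : X) (y0 : Y).
Notation SA := (own P (nr P).+1).

Definition fin_amp (x : X) (y : Y) (a : QS SA) (b : QS (~: SA)) : C :=
  amp P (nr P).+1 x y (qglue a b).

Definition sqrt_unif (T : finType) : C := (Num.sqrt (#|T|%:R^-1 : R))%:C%C.

Lemma sqrt_unifK (T : finType) : sqrt_unif T * (sqrt_unif T)^* = (#|T|%:R^-1 : R)%:C%C.
Proof. by rewrite conjC_real -rmorphM /= -expr2 sqr_sqrtr ?invr_ge0. Qed.

Lemma fin_amp_norm x y : \sum_a \sum_b nsq (fin_amp x y a b) = 1.
Proof. by rewrite -(amp_norm vP x y (leqnn _)) (sum_qglue SA). Qed.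

(** Alice's work qubits are the columns, so the Gram matrix F F^* traces them out and leaves Bob's
    registers. *)
Definition stateBY x : 'M[C]_(#|{: QS (~: SA) * Y}|, #|QS SA|) :=
  kmx (fun (be : QS (~: SA) * Y) a => fin_amp x be.2 a be.1 * sqrt_unif Y).

Definition stateAX y : 'M[C]_(#|{: QS SA * X}|, #|QS (~: SA)|) :=
  kmx (fun (al : QS SA * X) b => fin_amp al.2 y al.1 b * sqrt_unif X).

(** The final pure state with both inputs in superposition. Neither loss is evaluated on it; it is
    the purification that Bob steers. *)
Definition stateABXY : 'M[C]_(#|{: QS SA * X}|, #|{: QS (~: SA) * Y}|) :=
  kmx (fun (al : QS SA * X) (be : QS (~: SA) * Y) =>
    fin_amp al.2 be.2 al.1 be.1 * sqrt_unif X * sqrt_unif Y).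

Lemma nsq_sqrt_unif (T : finType) : nsq (sqrt_unif T) = #|T|%:R^-1.
Proof. by rewrite nsqR sqr_sqrtr ?invr_ge0. Qed.

Lemma card_unifK (T : finType) (t0 : T) (r : R) : \sum_(t : T) r * #|T|%:R^-1 = r.
Proof. by rewrite -[RHS](avg_const t0) /avg mulr_sumr; apply: eq_bigr => t _; rewrite mulrC. Qed.

Lemma fro_stateBY x : fro (stateBY x) = 1.
Proof.
rewrite fro_kmx exchange_big /=.
transitivity (\sum_(y : Y) 1 * #|Y|%:R^-1 : R); last exact: card_unifK.
transitivity (\sum_a \sum_b \sum_y nsq (fin_amp x y a b) * #|Y|%:R^-1).
  apply: eq_bigr => a _; rewrite pair_big /=; apply: eq_bigr => be _.
  by rewrite nsqM nsq_sqrt_unif.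
under eq_bigr do rewrite exchange_big.
rewrite exchange_big; apply: eq_bigr => y _ /=.
by under eq_bigr do rewrite -mulr_suml; rewrite -mulr_suml fin_amp_norm.
Qed.

Lemma fro_stateAX y : fro (stateAX y) = 1.
Proof.
rewrite fro_kmx /=.
transitivity (\sum_(x : X) 1 * #|X|%:R^-1 : R); last exact: card_unifK.
transitivity (\sum_a \sum_x \sum_b nsq (fin_amp x y a b) * #|X|%:R^-1).
  rewrite [RHS]pair_big /=; apply: eq_bigr => al _; apply: eq_bigr => b _.
  by rewrite nsqM nsq_sqrt_unif.
rewrite exchange_big; apply: eq_bigr => x _ /=.
by under eq_bigr do rewrite -mulr_suml; rewrite -mulr_suml fin_amp_norm.
Qed.

Lemma mixtureE (T : finType) (t t' : T) :
  mixture (@unif R T) t t' = if t == t' then (#|T|%:R^-1)%:C%C else 0.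
Proof. by []. Qed.

Lemma superpositionE (T : finType) (t t' : T) :
  superposition (@unif R T) t t' = sqrt_unif T * (sqrt_unif T)^*.
Proof. by []. Qed.

Lemma amp_sum1 (y : Y) x : \sum_q amp P (nr P).+1 x y q * (amp P (nr P).+1 x y q)^* = 1.
Proof.
rewrite -(rmorph1 (real_complex R)) -(amp_norm vP x y (leqnn _)) rmorph_sum.
by apply: eq_bigr => q _; rewrite /= nsqE.
Qed.

Lemma stateBY_gramE x (w w' : QS (~: SA) * Y) :
  (stateBY x *m (stateBY x) ^t*) (enum_rank w) (enum_rank w') =
  \sum_a (fin_amp x w.2 a w.1 * (fin_amp x w'.2 a w'.1)^*) * (#|Y|%:R^-1 : R)%:C%C.
Proof.
rewrite kmx_adj kmxM mxE !enum_rankK; apply: eq_bigr => a _.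
by rewrite -sqrt_unifK rmorphM /=; ring.
Qed.

Lemma stateAX_gramE y (w w' : QS SA * X) :
  (stateAX y *m (stateAX y) ^t*) (enum_rank w) (enum_rank w') =
  \sum_b (fin_amp w.2 y w.1 b * (fin_amp w'.2 y w'.1 b)^*) * (#|X|%:R^-1 : R)%:C%C.
Proof.
rewrite kmx_adj kmxM mxE !enum_rankK; apply: eq_bigr => a _.
by rewrite -sqrt_unifK rmorphM /=; ring.
Qed.

Lemma gram_density m l (F : 'M[C]_(m, l)) : fro F = 1 -> density (F *m F ^t*).
Proof. by move=> f1; split; [exact: psd_gram|rewrite -fro_trace f1]. Qed.

(** X is classical and uniform, so by [cq_entropy] S(X) - S(XBY) is minus the average entropy of
    Bob's conditional states. *)
Lemma loss_ABE : loss_AB P unif unif =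
  ent (mxavg (fun x => stateBY x *m (stateBY x) ^t*)) -
  avg (fun x => ent (stateBY x *m (stateBY x) ^t*)).
Proof.
rewrite /loss_AB run_pure addrAC.
set op0 := ptrace (fun a => a.1.1) _ _; set op1 := ptrace (fun a => (a.1.1, _, _)) _ _; set op2 := ptrace _ _ _.
have e0 t t' : op0 t t' = if t == t' then (#|X|%:R^-1)%:C%C else 0.
  rewrite /op0 (@ptrace_sum _ _ _ (Q (nq P) * Y)%type _ _ (fun x v => (x, v.1, v.2)))//; last first.
  - by move=> [[x q] y].
  - by move=> u [q y].
  rewrite -mixtureE -[RHS]mulr1.
  rewrite /pure_run /= [mixture _ t t']mixtureE; case: eqP => [<-|_]; last first.
    by rewrite mul0r big1// => v _; rewrite !mul0r.
  transitivity (\sum_y \sum_q (#|X|%:R^-1)%:C%C * (amp P (nr P).+1 t y q * (amp P (nr P).+1 t y q)^*) *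
     (#|Y|%:R^-1 : R)%:C%C).
    rewrite exchange_big pair_big /=; apply: eq_bigr => v _.
    by rewrite superpositionE sqrt_unifK.
  under eq_bigr do rewrite -mulr_suml -mulr_sumr amp_sum1 mulr1.
  by rewrite -mulr_sumr -rmorph_sum mulr1 -[X in _ = X]mulr1; congr (_ * _);
    rewrite -[\sum_ _ _](eq_bigr _ (fun _ _ => mul1r _)) card_unifK.
have e1 w w' : op1 w w' = if w.1.1 == w'.1.1 then (#|X|%:R^-1)%:C%C *
   (stateBY w.1.1 *m (stateBY w.1.1) ^t*) (enum_rank (w.1.2, w.2)) (enum_rank (w'.1.2, w'.2)) else 0.
  rewrite /op1 (@ptrace_sum _ _ _ (QS SA) _ _ (fun w a => (w.1.1, qglue a w.1.2, w.2)))//; last first.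
  - by move=> [[x q] y]; rewrite /= qglueK.
  - by move=> [[x q] y] a; rewrite /= qres_gluel.
  - by move=> [[x q] y] a; rewrite /= qres_gluer.
  rewrite stateBY_gramE /pure_run /= mixtureE; case: eqP => [<-|_]; last first.
    by rewrite big1// => v _; rewrite !mul0r.
  by rewrite mulr_sumr; apply: eq_bigr => a _; rewrite superpositionE sqrt_unifK /fin_amp -[LHS]mulrA.
have e2 w w' : op2 w w' = mxavg (fun x => stateBY x *m (stateBY x) ^t*) (enum_rank w) (enum_rank w').
  rewrite summxE /op2.
  rewrite (@ptrace_sum _ _ _ (X * QS SA)%type _ _ (fun w v => (v.1, qglue v.2 w.1, w.2))).
  - rewrite -(pair_big xpredT xpredT (fun x a => pure_run P (mixture unif) (superposition unif) (nr P).+1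
      (x, qglue a w.1, w.2) (x, qglue a w'.1, w'.2))) /=.
    apply: eq_bigr => x _; rewrite mxE stateBY_gramE mulr_sumr.
    apply: eq_bigr => a _; rewrite /pure_run /= mixtureE eqxx superpositionE sqrt_unifK.
    by rewrite /fin_amp -[LHS]mulrA.
  - by move=> [u y] [x a]; rewrite /= qres_gluer.
  - by move=> [u y] [x a]; rewrite /= qres_gluel.
  - by move=> [[x q] y]; rewrite /= qglueK.
have h2 : vN_entropy op2 = ent (mxavg (fun x => stateBY x *m (stateBY x) ^t*)).
  rewrite vN_entE; apply: (congr1 (@ent R _)).
  by apply/matrixP => i j; rewrite mxE e2 !enum_valK.
have h : vN_entropy op0 - vN_entropy op1 = - avg (fun x => ent (stateBY x *m (stateBY x) ^t*)).
  apply: (@cq_entropy _ X (QS (~: SA) * Y)%type _ x0 (fun x => stateBY x *m (stateBY x) ^t*)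
    (fun w => w.1.1) (fun w => (w.1.2, w.2)) (fun x s => (x, s.1, s.2)) op0 op1 _ _ _ _ e0 e1).
  - by move=> t; apply/gram_density/fro_stateBY.
  - by [].
  - by move=> t [].
  - by move=> [[]].
by rewrite h h2 addrC.
Qed.

Lemma loss_BAE : loss_BA P unif unif =
  ent (mxavg (fun y => stateAX y *m (stateAX y) ^t*)) -
  avg (fun y => ent (stateAX y *m (stateAX y) ^t*)).
Proof.
rewrite /loss_BA run_pure addrAC.
set op0 := ptrace (fun a => a.2) _ _; set op1 := ptrace (fun a => (a.2, _, _)) _ _; set op2 := ptrace _ _ _.
have e0 t t' : op0 t t' = if t == t' then (#|Y|%:R^-1)%:C%C else 0.
  rewrite /op0 (@ptrace_sum _ _ _ (X * Q (nq P))%type _ _ (fun y v => (v.1, v.2, y))); first last.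
  - by move=> [[x q] y].
  - by move=> u [q y].
  - by [].
  rewrite /pure_run /= [mixture _ t t']mixtureE; case: eqP => [<-|_]; last first.
    by rewrite big1// => v _; rewrite !mulr0.
  transitivity (\sum_x \sum_q (#|X|%:R^-1 : R)%:C%C * (amp P (nr P).+1 x t q * (amp P (nr P).+1 x t q)^*) *
     (#|Y|%:R^-1)%:C%C).
    rewrite pair_big /=; apply: eq_bigr => v _.
    by rewrite superpositionE sqrt_unifK.
  under eq_bigr do rewrite -mulr_suml -mulr_sumr amp_sum1 mulr1 mulrC.
  by rewrite -mulr_sumr -rmorph_sum -[X in _ = X]mulr1; congr (_ * _);
    rewrite -[\sum_ _ _](eq_bigr _ (fun _ _ => mul1r _)) card_unifK.
have e1 w w' : op1 w w' = if w.1.1 == w'.1.1 then (#|Y|%:R^-1)%:C%C *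
   (stateAX w.1.1 *m (stateAX w.1.1) ^t*) (enum_rank (w.1.2, w.2)) (enum_rank (w'.1.2, w'.2)) else 0.
  rewrite /op1 (@ptrace_sum _ _ _ (QS (~: SA)) _ _ (fun w b => (w.2, qglue w.1.2 b, w.1.1))); first last.
  - by move=> [[x q] y]; rewrite /= qglueK.
  - by move=> [[y q] x] b; rewrite /= qres_gluer.
  - by move=> [[y q] x] b; rewrite /= qres_gluel.
  rewrite stateAX_gramE /pure_run /= mixtureE; case: eqP => [<-|_]; last first.
    by rewrite big1// => v _; rewrite !mulr0.
  rewrite mulr_sumr; apply: eq_bigr => a _; rewrite superpositionE sqrt_unifK /fin_amp.
  by rewrite [LHS]mulrC [X in _ * X]mulrC.
have e2 w w' : op2 w w' = mxavg (fun y => stateAX y *m (stateAX y) ^t*) (enum_rank w) (enum_rank w').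
  rewrite summxE /op2.
  rewrite (@ptrace_sum _ _ _ (QS (~: SA) * Y)%type _ _ (fun w v => (w.2, qglue w.1 v.1, v.2))).
  - rewrite -(pair_big xpredT xpredT (fun b y => pure_run P (superposition unif) (mixture unif) (nr P).+1
      (w.2, qglue w.1 b, y) (w'.2, qglue w'.1 b, y))) exchange_big.
    apply: eq_bigr => y _; rewrite mxE stateAX_gramE mulr_sumr.
    apply: eq_bigr => b _; rewrite /pure_run /= mixtureE eqxx superpositionE sqrt_unifK.
    by rewrite /fin_amp [LHS]mulrC [X in _ * X]mulrC.
  - by move=> [u x] [b y]; rewrite /= qres_gluel.
  - by move=> [u x] [b y]; rewrite /= qres_gluer.
  - by move=> [[x q] y]; rewrite /= qglueK.
have h2 : vN_entropy op2 = ent (mxavg (fun y => stateAX y *m (stateAX y) ^t*)).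
  rewrite vN_entE; apply: (congr1 (@ent R _)).
  by apply/matrixP => i j; rewrite mxE e2 !enum_valK.
have h : vN_entropy op0 - vN_entropy op1 = - avg (fun y => ent (stateAX y *m (stateAX y) ^t*)).
  apply: (@cq_entropy _ Y (QS SA * X)%type _ y0 (fun y => stateAX y *m (stateAX y) ^t*)
    (fun w => w.1.1) (fun w => (w.1.2, w.2)) (fun y s => (y, s.1, s.2)) op0 op1 _ _ _ _ e0 e1).
  - by move=> t; apply/gram_density/fro_stateAX.
  - by [].
  - by move=> t [].
  - by move=> [[]].
by rewrite h h2 addrC.
Qed.

(** Bob's input only acts as a control, so tracing it out turns its superposition into the mixture.
    The hypothesis on Bob's privacy therefore concerns the very state that Bob steers. *)
Lemma stateABXY_gram :
  stateABXY *m stateABXY ^t* = mxavg (fun y => stateAX y *m (stateAX y) ^t*).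
Proof.
apply/matrixP => i j; rewrite -(enum_valK i) -(enum_valK j) summxE.
move: (enum_val i) (enum_val j) => w' w.
rewrite kmx_adj kmxM mxE !enum_rankK.
rewrite -(pair_big xpredT xpredT (fun b y => fin_amp w'.2 y w'.1 b * sqrt_unif X * sqrt_unif Y *
   (fin_amp w.2 y w.1 b * sqrt_unif X * sqrt_unif Y)^*)) exchange_big.
apply: eq_bigr => y _; rewrite mxE stateAX_gramE mulr_sumr; apply: eq_bigr => b _.
by rewrite -!sqrt_unifK !rmorphM /=; ring.
Qed.

(** One product of amplitudes grouped in two ways: N acts on Bob's half of the global state, or its
    transpose acts on Bob's state for a fixed x. This carries the bias over from one loss to the
    other. *)
Lemma steered_entry (N : 'M[C]_(#|{: QS (~: SA) * Y}|, #|QS (~: SA)|)) x a b :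
  nsq ((stateABXY *m N) (enum_rank (a, x)) b) =
  nsq ((N ^T *m stateBY x) b (enum_rank a)) * #|X|%:R^-1.
Proof.
rewrite -nsq_sqrt_unif -nsqM; congr nsq; rewrite !mxE mulr_suml.
by apply: eq_bigr => be _; rewrite !mxE !enum_rankK /=; ring.
Qed.

Lemma out_probE x y c :
  out_prob P x y c = \sum_(q : Q (nq P) | q (ans P) == c) nsq (amp P (nr P).+1 x y q).
Proof.
rewrite /out_prob run_pure (raddf_sum (@complex.Re R)) /=.
rewrite big_mkcond sum_triple (bigD1 x)//= [X in _ + X]big1 ?addr0 => [|x' /negPf xx]; last first.
  rewrite big1// => q _; rewrite big1// => y' _; case: ifP => // _.
  by rewrite /pure_run /basis_state /= xx !mul0r.
rewrite [RHS]big_mkcond; apply: eq_bigr => q _.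
rewrite (bigD1 y)//= [X in _ + X]big1 ?addr0 => [|y' /negPf yy]; last first.
  by case: ifP => // _; rewrite /pure_run /basis_state /= yy mulr0.
case: ifP => // _; rewrite /pure_run /basis_state /= !eqxx mul1r mulr1.
by rewrite -nsqE.
Qed.

Lemma out_prob_bias x y c :
  \sum_a \sum_b sgb R c * sgb R (qglue a b (ans P)) * nsq (fin_amp x y a b) =
  1 - 2 * out_prob P x y (~~ c).
Proof.
rewrite out_probE -[X in _ = X - _](amp_norm vP x y (leqnn _)) [X in _ - 2 * X]big_mkcond mulr_sumr -sumrB.
rewrite [RHS](sum_qglue SA); apply: eq_bigr => a _; apply: eq_bigr => b _.
rewrite /fin_amp; move: (nsq _) => r; rewrite /sgb.
by case: c (qglue a b (ans P)) => [] [] /=; rewrite ?expr0 ?expr1; ring.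
Qed.

Lemma qglue_ansl (a : QS SA) (b b' : QS (~: SA)) : ans P \in SA -> qglue a b (ans P) = qglue a b' (ans P) :> bool.
Proof. by move=> h; rewrite !ffunE !insubT. Qed.

Lemma qglue_ansr (a a' : QS SA) (b : QS (~: SA)) : ans P \notin SA -> qglue a b (ans P) = qglue a' b (ans P) :> bool.
Proof. by move=> h; rewrite !ffunE insubN. Qed.

End Loss.

(** * Constants, and assembly of the bound *)

Section Main.
Variable R : realType.
Notation C := R[i].

Lemma ln2_ge : 2^-1 <= ln 2 :> R.
Proof.
have := @ln_le_sub1 R 2^-1; rewrite invr_gt0 lnV ?posrE// => /(_ (ltr0n R 2)); lra.
Qed.

Lemma ln2_le1 : ln 2 <= 1 :> R.
Proof. by have := @ln_le_sub1 R 2 (ltr0n R 2); lra. Qed.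

Lemma bound_arith (m eps k : R) : 0 <= m -> 0 < eps -> eps <= 1 / 2 -> 0 <= k ->
  m / (2 `^ (eps ^-3 * (14 * k + 24))) - 2 <=
  m * eps ^+ 2 / (4 * (expR (4 * (k * ln 2 + 1) / eps ^+ 2) / 4) ^+ 2 * ln 2) - 1.
Proof.
move=> m0 e0 e1 k0; set E := eps ^-3 * (14 * k + 24); set L := 4 * (k * ln 2 + 1) / eps ^+ 2.
have l2 := ln2_gt0 R; have h2 := ln2_ge; have h1 := ln2_le1.
have e2 : 0 < eps ^+ 2 by rewrite exprn_gt0.
set u := (eps ^+ 2)^-1; have u0 : 0 < u by rewrite invr_gt0.
(* The argument yields an exponent of order eps^-2; eps <= 1/2 gives a further factor 2 on passing
   to eps^-3. *)
have u3 : 2 * u <= eps ^-3.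
  rewrite -[eps ^-3]/((eps ^+ 3)^-1) exprS invfM -/u ler_wpM2r ?(ltW u0)//.
  rewrite -[2]invrK lef_pV2 ?posrE ?invr_gt0//; lra.
(* The extra u absorbs the prefactor eps^-2, as u <= exp u. What is compared is 8 k ln 2 + 9 with 28
   k ln 2 + 48 ln 2, where ln 2 >= 1/2. *)
have hE : 2 * L + u <= E * ln 2.
  apply: le_trans (_ : 2 * u * (14 * k + 24) * ln 2 <= _); last first.
    by rewrite ler_wpM2r ?(ltW l2)// /E ler_wpM2r//; lra.
  have -> : 2 * L + u = u * (8 * k * ln 2 + 9) by rewrite /L -/u; ring.
  have -> : 2 * u * (14 * k + 24) * ln 2 = u * (28 * k * ln 2 + 48 * ln 2) by ring.
  rewrite ler_wpM2l ?(ltW u0)//.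
  by have : 0 <= k * ln 2 by [rewrite mulr_ge0// ltW]; rewrite -!mulrA; lra.
have -> : 2 `^ E = expR (E * ln 2) by rewrite -{1}(lnK (_ : 2 \in Num.pos)) ?posrE// mulrC -expRM.
suff h : (expR (E * ln 2))^-1 <= eps ^+ 2 / (4 * (expR L / 4) ^+ 2 * ln 2).
  have := ler_wpM2l m0 h; rewrite mulrA; lra.
have xL := expR_gt0 L.
have -> : eps ^+ 2 / (4 * (expR L / 4) ^+ 2 * ln 2) = (expR L ^+ 2 * (u * (ln 2 / 4)))^-1.
  by rewrite /u; field; rewrite !gt_eqF.
rewrite lef_pV2 ?posrE ?expR_gt0 ?mulr_gt0 ?exprn_gt0 ?invr_gt0//.
apply: le_trans (_ : expR (2 * L + u) <= _); last by rewrite ler_expR.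
rewrite expRD expRM_natl ler_wpM2l ?sqr_ge0//.
apply: le_trans (_ : u * 1 <= _); first by rewrite ler_wpM2l ?(ltW u0)//; lra.
by rewrite mulr1; apply: le_trans (expR_ge1Dx _); lra.
Qed.

End Main.

Lemma privacy_tradeoff (R : realType) (n : nat) (eps k : R)
    (P : protocol R {ffun 'I_n -> bool} 'I_n) :
  (1 <= n)%N -> 0 < eps -> 0 <= k -> valid_protocol P ->
  dist_error P (@SetMemb n) unif unif <= 1 / 2 - eps ->
  loss_BA P unif unif <= k ->
  n%:R * eps ^+ 2 / (4 * (expR (4 * (k * ln 2 + 1) / eps ^+ 2) / 4) ^+ 2 * ln 2) - 1
    <= loss_AB P unif unif.
Proof.
move=> n0 e0 k0 vP herr; pose X := {ffun 'I_n -> bool}.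
pose x0 : X := [ffun=> false]; pose y0 : 'I_n := Ordinal n0.
rewrite (loss_ABE vP x0 y0) (loss_BAE vP x0 y0) => hk.
pose SA := own P (nr P).+1.
(* Arbitrary fillers: the answer qubit lies on one side, and its value ignores the configuration of
   the other. *)
pose a0 : QS SA := [ffun=> false]; pose b0 : QS (~: SA) := [ffun=> false].
pose ansA := ans P \in SA.
pose zA (a : 'I_#|QS SA|) : bool := qglue (enum_val a) b0 (ans P).
pose zB (b : 'I_#|QS (~: SA)|) : bool := qglue a0 (enum_val b) (ans P).
have ansE a b : qglue a b (ans P) = if ansA then zA (enum_rank a) else zB (enum_rank b).
  rewrite /zA /zB !enum_rankK; case: ifP => h; first exact: qglue_ansl.
  by apply: qglue_ansr; rewrite -/SA -/ansA h.
(* This is +1 when the answer equals x_i and -1 otherwise. It is diagonal in x, so its expectation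
   is the same for a superposed and for a mixed x. *)
pose th (i : 'I_n) (al : 'I_#|{: QS SA * X}|) (b : 'I_#|QS (~: SA)|) : R :=
  sgb R ((enum_val al).2 i) *
  sgb R (if ansA then zA (enum_rank (enum_val al).1) else zB b).
have sumAX (f : 'I_#|{: QS SA * X}| -> R) :
    \sum_al f al = \sum_(x : X) \sum_a f (enum_rank (a, x)).
  rewrite exchange_big pair_big /= -[RHS]sum_enum_val.
  by apply: eq_bigr => al _; rewrite -surjective_pairing enum_valK.
have thE i a x b : th i (enum_rank (a, x)) b =
    sgb R (x i) * sgb R (if ansA then zA (enum_rank a) else zB b).
  by rewrite /th enum_rankK.
have th1 i al b : `|th i al b| <= 1 by rewrite /th /sgb normrM !normr_sign mulr1.
(* Probability of success minus probability of failure, on average 1 - 2 err with err <= 1/2 -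
   eps. *)
have hb : 2 * eps <= avg (fun i => \sum_al \sum_b th i al b * nsq (stateAX P i al b)).
  have e i : \sum_al \sum_b th i al b * nsq (stateAX P i al b) =
      avg (fun x : X => 1 - 2 * out_prob P x i (~~ SetMemb n x i)).
    rewrite sumAX /avg mulr_sumr; apply: eq_bigr => x _.
    rewrite -(out_prob_bias vP) mulr_sumr; apply: eq_bigr => a _.
    rewrite mulr_sumr -[RHS]sum_enum_val; apply: eq_bigr => b _.
    rewrite thE ansE enum_valK mxE enum_rankK nsqM nsq_sqrt_unif /SetMemb.
    by rewrite mulrA mulrC.
  rewrite (eq_avg e).
  have -> : avg (fun i : 'I_n => avg (fun x : X => 1 - 2 * out_prob P x i (~~ SetMemb n x i))) =
      1 - 2 * dist_error P (@SetMemb n) unif unif.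
    have e1 i : avg (fun x : X => 1 - 2 * out_prob P x i (~~ SetMemb n x i)) =
       1 - 2 * avg (fun x : X => out_prob P x i (~~ SetMemb n x i)).
      by rewrite avgB (avg_const x0) avgZ.
    rewrite (eq_avg e1) avgB (avg_const y0) avgZ; congr (1 - 2 * _).
    rewrite /dist_error exchange_big /avg mulr_sumr; apply: eq_bigr => i _.
    rewrite !mulr_sumr; apply: eq_bigr => x _; rewrite /unif; ring.
  by move: herr; move: (dist_error _ _ _ _) => e1 h; lra.
have l2 := ln2_gt0 R.
have K0 : 0 <= k * ln 2 by rewrite mulr_ge0// ltW.
have hK : (ent (stateABXY P *m (stateABXY P) ^t*) -
     avg (fun i => ent (stateAX P i *m (stateAX P i) ^t*))) * ln 2 <= k * ln 2.
  by rewrite stateABXY_gram ler_pM2r.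
have [N [cN hN]] := steering_bias y0 e0 K0 (stateABXY_gram P) (fro_stateAX vP x0) th1 hK hb.
have c0 : 0 < expR (4 * (k * ln 2 + 1) / eps ^+ 2) / 4 by rewrite divr_gt0 ?expR_gt0.
apply: (info_lower (N := N) (zA := zA) (zB := zB) (ansA := ansA) _ c0 e0 cN).
  exact: fro_stateBY vP y0.
apply: le_trans hN _; rewrite le_eqVlt; apply/orP; left; apply/eqP.
apply: eq_avg => i; rewrite sumAX /avg mulr_sumr; apply: eq_bigr => x _.
rewrite mulrA [RHS]mulr_sumr exchange_big; apply: eq_bigr => b _ /=.
rewrite mulr_sumr -sum_enum_val; apply: eq_bigr => a _.
by rewrite thE steered_entry enum_valK; ring.
Qed.

Theorem theorem1 (R : realType) (n : nat) (eps k : R)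
  (P : protocol R {ffun 'I_n -> bool} 'I_n) :
  (1 <= n)%N ->
  0 < eps -> eps <= 1 / 2 -> 0 <= k ->
  valid_protocol P ->
  dist_error P (@SetMemb n) unif unif <= 1 / 2 - eps ->
  loss_BA P unif unif <= k ->
  loss_AB P unif unif >=
    n%:R / (2 `^ (eps ^-3 * (14 * k + 24))) - 2.
Proof.
move=> n1 e0 e2 k0 vP herr hk.
apply: le_trans (privacy_tradeoff n1 e0 k0 vP herr hk).
exact: bound_arith.
Qed.
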